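(* Let $0<\alpha\le1$, $1\le p\le\infty$, let $N$ be a prime and $1\le s<N$. Let $Q_{N,s}=\{\boldsymbol{y}_0,\dots,\boldsymbol{y}_{N-1}\}$ with $\boldsymbol{y}_n=\phi\big(\{n/N\},\{n^2/N\},\dots,\{n^s/N\}\big)$. Then $$\mathrm{e}(C_{\alpha,p},Q_{N,s})\le\max\Big(\frac{s-1}{\sqrt N},\frac{s^{\alpha/p}}{N^\alpha}\Big).$$
   Context: $\{x\}=x-\lfloor x\rfloor$; $s^{\alpha/p}=1$ if $p=\infty$. Tent transform: $\phi(t)=1-|2t-1|$ for $t\in[0,1]$, applied componentwise to vectors. Cosine basis: $\sigma_0(x)=1$, $\sigma_k(x)=\sqrt2\cos(\pi kx)$ for $k\in\mathbb{N}$, $\sigma_{\boldsymbol{k}}(\boldsymbol{x})=\prod_{j=1}^s\sigma_{k_j}(x_j)$ for $\boldsymbol{k}\in\mathbb{N}_0^s$. For $g\in L^2([0,1]^s)$, $\widehat g(\boldsymbol{k})=\int_{[0,1]^s}g(\boldsymbol{x})\sigma_{\boldsymbol{k}}(\boldsymbol{x})d\boldsymbol{x}$. Hölder seminorm $|g|_{H_{\alpha,p}}=\sup\{|g(\boldsymbol{x}+\boldsymbol{h})-g(\boldsymbol{x})|/\|\boldsymbol{h}\|_{\ell^p}^\alpha:\boldsymbol{h}\ne\boldsymbol{0},\ \boldsymbol{x},\boldsymbol{x}+\boldsymbol{h}\in[0,1)^s\}$. For $u\subseteq\{1,\dots,s\}$ and $\boldsymbol{k}_u\in\mathbb{N}^u$,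 $(\boldsymbol{k}_u,\boldsymbol{0})\in\mathbb{N}_0^s$ has $j$th entry $k_j$ for $j\in u$ and $0$ otherwise. $C_{\alpha,p}$ is the space of real-valued $g\in L^2([0,1]^s)$ (no periodicity required) with finite norm $\|g\|_{C_{\alpha,p}}=\sum_{u\subseteq\{1,\dots,s\}}2^{|u|/2}\sum_{\boldsymbol{k}_u\in\mathbb{N}^u}|\widehat g((\boldsymbol{k}_u,\boldsymbol{0}))|+2^\alpha|g|_{H_{\alpha,p}}$. Worst-case error $\mathrm{e}(B,U)=\sup_{\|g\|_B\le1}|\int_{[0,1]^s}g-\frac1{|U|}\sum_{\boldsymbol{x}\in U}g(\boldsymbol{x})|$, points counted with multiplicity.
   Formalization: The Hölder seminorm is taken over the closed cube [0,1]^s instead of [0,1)^s (g is its continuous representative); otherwise for N=2, s=1 the point y_1=1 lies outside [0,1), g(1) is unconstrained and the error is unbounded. *)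

(* Defs.v *)
From Stdlib Require Import Reals Lra Lia List ZArith Znumtheory.
Import ListNotations.
Open Scope R_scope.

Definition rsum {A : Type} (f : A -> R) (l : list A) : R :=
  fold_right Rplus 0 (map f l).

Fixpoint tuples (n m : nat) : list (list nat) :=
  match n with
  | O => [nil]
  | S n' => flat_map (fun i => map (cons i) (tuples n' m)) (seq 0 m)
  end.

(* all subsets u of {1..n}, as boolean masks of length n *)
Fixpoint blists (n : nat) : list (list bool) :=
  match n with
  | O => [nil]
  | S n' => flat_map (fun b => map (cons b) (blists n')) [true; false]
  end.

(* all (k_u, 0) with k_u in {1..M}^u, for u given as a mask *)
Fixpoint ktuples (b : list bool) (M : nat) : list (list nat) :=
  match b with
  | nil => [nil]
  | true :: b' => flat_map (fun i => map (cons i) (ktuples b' M)) (seq 1 M)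
  | false :: b' => map (cons 0%nat) (ktuples b' M)
  end.

Definition in_cube (s : nat) (x : list R) : Prop :=
  length x = s /\ Forall (fun t => 0 <= t <= 1) x.

(* Riemann integral over [0,1]^s : limit of Riemann sums on uniform grids
   with M^s cells and arbitrary tags in the (closed) cells. *)
Definition is_integral (s : nat) (g : list R -> R) (I : R) : Prop :=
  forall eps, 0 < eps -> exists M0 : nat, forall (M : nat) (tag : list nat -> list R),
    (1 <= M)%nat -> (M0 <= M)%nat ->
    (forall i, In i (tuples s M) ->
       length (tag i) = s /\
       forall j, (j < s)%nat ->
         INR (nth j i 0%nat) / INR M <= nth j (tag i) 0 <= INR (S (nth j i 0%nat)) / INR M) ->
    Rabs (/ (INR M ^ s) * rsum (fun i => g (tag i)) (tuples s M) - I) < eps.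

Definition sigma1 (k : nat) (x : R) : R :=
  match k with
  | O => 1
  | S _ => sqrt 2 * cos (PI * INR k * x)
  end.

Definition sigma (k : list nat) (x : list R) : R :=
  fold_right Rmult 1 (map (fun kx => sigma1 (fst kx) (snd kx)) (combine k x)).

Inductive pexp : Type := pfin (p : R) | pinf.

Definition valid_p (p : pexp) : Prop :=
  match p with pfin q => 1 <= q | pinf => True end.

Definition pw (a q : R) : R := if Req_EM_T a 0 then 0 else Rpower a q.

Definition lpnorm (p : pexp) (h : list R) : R :=
  match p with
  | pfin q => Rpower (rsum (fun t => pw (Rabs t) q) h) (/ q)
  | pinf => fold_right Rmax 0 (map Rabs h)
  end.

Definition vsub (y x : list R) : list R := map (fun yx => fst yx - snd yx) (combine y x).

Definition holder_bound (s : nat) (alpha : R) (p : pexp) (g : list R -> R) (L : R) : Prop :=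
  forall x y, in_cube s x -> in_cube s y -> x <> y ->
    Rabs (g y - g x) <= L * Rpower (lpnorm p (vsub y x)) alpha.

(* sum_{u} 2^{|u|/2} sum_{k_u in {1..M}^u} |c (k_u,0)|  (partial sums) *)
Definition coefsum (s : nat) (c : list nat -> R) (M : nat) : R :=
  rsum (fun b => sqrt 2 ^ (count_occ Bool.bool_dec b true) *
                 rsum (fun k => Rabs (c k)) (ktuples b M)) (blists s).

Definition in_unit_ball (s : nat) (alpha : R) (p : pexp) (g : list R -> R) : Prop :=
  exists (c : list nat -> R) (S L : R),
    (forall k, length k = s -> is_integral s (fun x => g x * sigma k x) (c k)) /\
    (forall M, coefsum s c M <= S) /\
    0 <= L /\ holder_bound s alpha p g L /\
    S + Rpower 2 alpha * L <= 1.

Definition phi (t : R) : R := 1 - Rabs (2 * t - 1).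

Definition ypt (N s n : nat) : list R :=
  map (fun j => phi (frac_part (INR (n ^ j) / INR N))) (seq 1 s).

Definition qmc_avg (N s : nat) (g : list R -> R) : R :=
  / INR N * rsum (fun n => g (ypt N s n)) (seq 0 N).

Definition s_pow (s : nat) (alpha : R) (p : pexp) : R :=
  match p with pfin q => Rpower (INR s) (alpha / q) | pinf => 1 end.

(* Main.v *)
Require Import Defs.
From Stdlib Require Import Reals Lra Lia Psatz List ZArith Znumtheory Permutation.
From mathcomp Require all_boot all_order all_algebra all_field zify ring complex Rstruct.
(* [Reals] also defines a [sigma]. *)
Import Defs.
Open Scope R_scope.

(** Let [G] be the average over the full grid of the [N^s] points [phi(i/N)].
    The grid is a set of tags, one in each cell of a partition of the cube into
    [N^s] cells, so the Hoelder condition gives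
    [|G(g) - integral g| <= |g| s^(alpha/p) / N^alpha].  The difference between
    the average over [Q_{N,s}] and [G] is estimated on the cosine series of [g]
    (made finite by Fejer weights in [0, 1]): the two averages agree on
    [sigma_k] when [N] divides [k], and otherwise the grid average is [0] while
    the other one is an average over signs of exponential sums of nonconstant
    polynomials of degree at most [s < N], bounded by Weil's inequality.

    Weil's inequality [|sum_n e(F(n)/p)| <= (d-1) sqrt p] is obtained from the
    L-function of [F].  Its coefficients, sums over monic polynomials over
    [F_p], vanish from degree [d] on by Newton's identities, so the sums [S_n]
    over [F_{p^n}] are minus the power sums of [d-1] numbers [w].  Stepanov's
    method gives [S_{2m} = O(p^m)], which forces [|w| <= sqrt p]. *)

(** Frequencies divisible by [N] are aliased in the same way by both rules, so no decay of their
    coefficients is needed; the grid charges them to the Hoelder seminorm. The two errors are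
    [A * S0] and [B * L], with [S0] a bound of the weighted coefficient sum and [L] of the seminorm,
    and [S0 + L <= 1] turns their sum into a maximum. The tent map gives
    [cos (PI k phi(t)) = cos (2 PI k t)], so half-period cosines become characters modulo [N], whose
    amplitudes [sqrt 2] multiply to the weight [2^(|u|/2)] of the norm. Integrals are known only as
    limits of Riemann sums; Fejer means are therefore formed with midpoint sums, which are exact on
    the kernel once the mesh is fine enough. Stepanov's method bounds each fibre of the trace from
    above only. This suffices, as the values of the character sum to zero and the fibre sizes have a
    known total. It is run in even degrees, where the trace splits into conjugate halves; that
    controls the power sums of the squares [w ^ 2]. Since [d < p], the number [d] is invertible
    modulo [p], as needed both for the vanishing coefficients and for distinct degrees in the
    auxiliary polynomial. *)

Definition nat_poly (a : nat -> nat) (d n : nat) : nat :=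
  fold_right Nat.add 0%nat (map (fun j => (a j * n ^ j)%nat) (seq 0 (S d))).
Definition unit_cos_sum (N : nat) (f : nat -> nat) : R :=
  rsum (fun n => cos (2 * PI * INR (f n) / INR N)) (seq 0 N).

(** * Weil's bound for additive character sums *)

Module WeilBound.
Import all_boot all_order all_algebra all_field zify ring complex Rstruct.
Set Implicit Arguments.
Unset Strict Implicit.
Unset Printing Implicit Defensive.
Import Order.TTheory GRing.Theory Num.Theory.
Local Close Scope R_scope.
Local Open Scope ring_scope.

(** * Newton's identities *)

Section Newton.
Variable R : comNzRingType.
Implicit Types (l : seq R).

Definition psum l i : R := \sum_(t <- l) t ^+ i.
Definition esgn l : {poly R} := \prod_(t <- l) (1 - t *: 'X).

Lemma esgn_cons t l j :
  (esgn (t :: l))`_j = (esgn l)`_j - (if j is j'.+1 then t * (esgn l)`_j' else 0).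
Proof.
rewrite /esgn big_cons mulrBl mul1r coefB -scalerAl coefZ coefXM.
by case: j => [|j] /=; rewrite ?mulr0.
Qed.

(** Coefficient form of the logarithmic derivative of [esgn l], whose coefficients are the signed
    elementary symmetric functions. Stated without division, it serves in characteristic [p] as well
    as over the complex numbers. *)
Lemma newton_psum l j :
  (esgn l)`_j *+ j = - \sum_(i < j) psum l i.+1 * (esgn l)`_(j - i.+1).
Proof.
elim: l j => [|t l IH] j.
  rewrite big1 ?oppr0 => [|i _]; last by rewrite /psum big_nil mul0r.
  by case: j => [|j]; rewrite ?mulr0n // /esgn big_nil coef1 mul0rn.
case: j => [|j]; first by rewrite big_ord0 oppr0 mulr0n.
have pc i : psum (t :: l) i = t ^+ i + psum l i by rewrite /psum big_cons.
under eq_bigr do rewrite pc mulrDl.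
rewrite big_split /= opprD.
(* Multiplying [esgn (t :: l)] by the geometric series of [t *: 'X] gives back [esgn l]. *)
have -> : \sum_(i < j.+1) t ^+ i.+1 * (esgn (t :: l))`_(j.+1 - i.+1) = t * (esgn l)`_j.
  elim: {IH} j => [|j IHj].
    by rewrite big_ord_recl big_ord0 addr0 expr1 subnn esgn_cons subr0.
  rewrite big_ord_recl /= subSS subn0 esgn_cons expr1.
  under eq_bigr => i _ do rewrite /bump /= add1n exprS -mulrA.
  rewrite -mulr_sumr.
  rewrite -[RHS]addr0 mulrBr -addrA; congr (_ + _).
  rewrite addrC -mulrBr; apply/eqP; rewrite (_ : _ - _ = 0) ?mulr0 //.
  by apply/eqP; rewrite subr_eq0; apply/eqP; rewrite -IHj; apply: eq_bigr => i _; rewrite !subSS.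
rewrite esgn_cons.
have IHj := IH j; have IHj1 := IH j.+1.
have -> : \sum_(i < j.+1) psum l i.+1 * (esgn (t :: l))`_(j.+1 - i.+1) =
  \sum_(i < j.+1) psum l i.+1 * (esgn l)`_(j.+1 - i.+1) -
  t * \sum_(i < j) psum l i.+1 * (esgn l)`_(j - i.+1).
  rewrite mulr_sumr [in RHS]big_ord_recr /= [in LHS]big_ord_recr /= subnn esgn_cons subr0.
  rewrite -addrA [X in _ = _ + X]addrC addrA -sumrB; congr (_ + _).
  apply: eq_bigr => i _; rewrite esgn_cons !subSS.
  have -> : (j - i = (j - i.+1).+1)%N by have := ltn_ord i; lia.
  by rewrite mulrBr mulrCA.
rewrite opprB.
have -> : t * \sum_(i < j) psum l i.+1 * (esgn l)`_(j - i.+1) = - (t * ((esgn l)`_j *+ j)).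
  by rewrite IHj mulrN opprK.
rewrite mulrnBl IHj1 mulrSr -mulrnAr; ring.
Qed.

Lemma size_esgn l : (size (esgn l) <= (size l).+1)%N.
Proof.
elim: l => [|a l' IHl]; first by rewrite /esgn big_nil size_poly1.
rewrite /esgn big_cons; apply: leq_trans (size_polyMleq _ _) _.
have : (size (1 - a *: 'X : {poly R})%R <= 2)%N.
  apply: leq_trans (size_polyD _ _) _; rewrite geq_max size_poly1 size_polyN.
  by apply: leq_trans (size_scale_leq _ _) _; rewrite size_polyX.
move: IHl; rewrite /esgn /=; set A := size _; set B := size _; clear; lia.
Qed.

(** Reversal of coefficients: [1 - t *: 'X] is the reciprocal polynomial of ['X - t%:P]. *)
Lemma coef_esgn l j : (j <= size l)%N ->
  (esgn l)`_j = (\prod_(t <- l) ('X - t%:P))`_(size l - j).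
Proof.
elim: l j => [|t l IH] j /=.
  by rewrite leqn0 => /eqP ->; rewrite /esgn !big_nil.
have mon : (\prod_(t <- l) ('X - t%:P))`_(size l).+1 = 0.
  by rewrite nth_default // size_prod_XsubC.
rewrite big_cons mulrBl coefB coefXM mul_polyC coefZ esgn_cons.
case: j => [|j] jl.
  rewrite subn0 /= subr0 mon mulr0 subr0 IH //.
  by rewrite subn0.
rewrite subSS -IH //.
case: (ltnP j (size l)) => jl2.
  rewrite IH // ifN; last by lia.
  by rewrite (_ : (size l - j).-1 = (size l - j.+1)%N) //; lia.
have -> : j = size l by lia.
rewrite subnn eqxx [RHS]sub0r; apply/eqP; rewrite subr_eq addNr; apply/eqP.
by rewrite nth_default // size_esgn.
Qed.

End Newton.

(** * Linear dependence and independence of polynomials *)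

Section LinearAlgebra.
Variables (K : fieldType) (T : finType) (P : T -> {poly K}).

Lemma poly_lin_dep D : (forall t, size (P t) <= D)%N -> (D < #|T|)%N ->
  exists c : T -> K, (exists t, c t != 0) /\ \sum_t c t *: P t = 0.
Proof.
move=> szP ltD.
pose M := \matrix_(i < #|T|, j < D) (P (enum_val i))`_j.
have : kermx M != 0.
  by rewrite -mxrank_eq0 mxrank_ker -lt0n subn_gt0 (leq_ltn_trans (rank_leq_col M)).
case/rowV0Pn => v /sub_kermxP vM v0.
exists (fun t => v 0 (enum_rank t)); split.
  have [j vj] : exists j, v 0 j != 0.
    apply/existsP; apply: contraNT v0; rewrite negb_exists => /forallP v0.
    by apply/eqP/rowP => j; rewrite mxE; apply/eqP; have := v0 j; rewrite negbK.
  by exists (enum_val j); rewrite enum_valK.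
apply/polyP => j; rewrite coef_sum coef0.
case: (ltnP j D) => jD; last first.
  by apply: big1 => t _; rewrite coefZ nth_default ?mulr0 // (leq_trans (szP t)).
have /rowP/(_ (Ordinal jD)) := vM; rewrite !mxE; apply: etrans.
rewrite (reindex (@enum_val T T)) /=; last first.
  by exists enum_rank => x _; rewrite ?enum_valK ?enum_rankK.
by apply: eq_bigr => i _; rewrite coefZ mxE enum_valK.
Qed.

(** Since the sizes are distinct, nothing can cancel the leading term of the largest polynomial with
    a nonzero coefficient. *)
Lemma poly_lin_indep (c : T -> K) :
  (forall t, P t != 0) -> injective (fun t => size (P t)) ->
  (exists t, c t != 0) -> \sum_t c t *: P t != 0.
Proof.
move=> P0 szI [t0 ct0].
case: (arg_maxnP (P := fun t => c t != 0) (fun t => size (P t)) ct0) => t ct tmax.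
apply/eqP => /(congr1 (fun q : {poly K} => q`_(size (P t)).-1)).
rewrite coef0 coef_sum (bigD1 t) //= big1 ?addr0 => [|u ut].
  by rewrite coefZ -lead_coefE => /eqP; rewrite mulf_eq0 (negPf ct) lead_coef_eq0 (negPf (P0 t)).
rewrite coefZ; have [->|cu] := eqVneq (c u) 0; first by rewrite mul0r.
rewrite nth_default ?mulr0 // -ltnS prednK ?size_poly_gt0 //.
have := tmax _ cu; rewrite /= ltn_neqAle => ->; rewrite andbT; apply: contra ut => /eqP e.
by apply/eqP/szI.
Qed.

End LinearAlgebra.

(** * Frobenius powers, and two numerical inequalities for Stepanov's method *)

Section Frobenius.
Variables (K : comNzRingType) (p : nat) (pK : p \in [pchar K]).

Lemma frobD m (x y : K) : (x + y) ^+ (p ^ m) = x ^+ (p ^ m) + y ^+ (p ^ m).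
Proof. by apply: exprDn_pchar; rewrite (eq_pnat _ (pcharf_eq pK)) pnatX pnat_id ?orTb // (pcharf_prime pK). Qed.

Lemma frob_sum m (I : Type) (r : seq I) (P : pred I) (f : I -> K) :
  (\sum_(i <- r | P i) f i) ^+ (p ^ m) = \sum_(i <- r | P i) f i ^+ (p ^ m).
Proof.
apply: (big_morph (fun x => x ^+ (p ^ m)) (frobD m)).
by rewrite expr0n expn_eq0 eqn0Ngt prime_gt0 ?(pcharf_prime pK).
Qed.

End Frobenius.

(** The left side bounds the sizes of the polynomials [P t] in [stepanov], the right side counts
    their indices [(a, b, l)]. The [d] extra values of [a] pay for the degree of the factor
    [(c - h) ^ b]. *)
Lemma stepanov_unknowns (rho p d : nat) : (0 < rho)%N -> (1 < p)%N -> (0 < d)%N ->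
  ((p * rho * rho.-1 + (rho + d).-1 + p.-1 * (d * rho)).+1 < (rho + d) * p * rho)%N.
Proof.
move=> r0 p1 d0.
have [k ->] : exists k, rho = k.+1 by exists rho.-1; rewrite prednK.
have [q ->] : exists q, p = q.+2 by exists p.-2; lia.
have [e ->] : exists e, d = e.+1 by exists d.-1; rewrite prednK.
rewrite (_ : (k.+1 + e.+1).-1 = (k + e.+1)%N) ?(succnK k) ?(succnK q.+1); last by reflexivity.
(* This is the difference of the two sides, less one for strictness; it leaves [lia] a problem that
   is linear in the monomials. *)
have := leq0n (k * q + k * e + 2 * k + q).
lia.
Qed.

(** In [stepanov] the left side bounds the size of [G]. With [r = p * rho], the term [rho * r] is
    [r * r / p], the mean size of a trace fibre, and [2 * d * r] is an excess of square root
    order. *)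
Lemma stepanov_degree (rho p d : nat) : (0 < rho)%N -> (1 < p)%N -> (0 < d)%N ->
  ((rho.-1 + (rho + d).-1 * (p * rho) + p.-1 * (d * rho)).+1
     <= rho * (p * rho) + 2 * d * (p * rho))%N.
Proof.
move=> r0 p1 d0.
have [k ->] : exists k, rho = k.+1 by exists rho.-1; rewrite prednK.
have [q ->] : exists q, p = q.+2 by exists p.-2; lia.
have [e ->] : exists e, d = e.+1 by exists d.-1; rewrite prednK.
rewrite (_ : (k.+1 + e.+1).-1 = (k + e.+1)%N) ?(succnK k) ?(succnK q.+1); last by reflexivity.
have := leq0n ((k + 1) * (q + e + 2)).
lia.
Qed.

(** * Stepanov's method *)

Section Stepanov.
Variables (K : closedFieldType) (p : nat) (pK : p \in [pchar K]).
Variables (F : {poly K}) (d : nat) (szF : size F = d.+1) (d0 : (0 < d)%N) (dp : (d < p)%N).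

Let p0 : (0 < p)%N := prime_gt0 (pcharf_prime pK).

(* the trace form [\sum_(i < 2 * m) F ^+ (p ^ i)] is [h + h ^+ (p ^ m)] for [h = half_trace m] *)
Definition half_trace m : {poly K} := \sum_(i < m) F ^+ (p ^ i).

Lemma size_half_trace m : size (half_trace m.+1) = (d * p ^ m).+1.
Proof.
have F0 : F != 0 by rewrite -size_poly_gt0 szF.
have szFi i : size (F ^+ (p ^ i)) = (d * p ^ i).+1.
  by have := size_exp F (p ^ i); rewrite szF /= => <-; rewrite prednK // size_poly_gt0 expf_neq0.
rewrite /half_trace big_ord_recr /= addrC size_polyDl ?szFi // ltnS.
apply: (leq_trans (size_sum _ _ _)); apply/bigmax_leqP => i _.
rewrite szFi ltn_pmul2l // ltn_exp2l ?prime_gt1 ?(pcharf_prime pK) //.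
Qed.

(* With [r = p ^ m.+1] and [h] the half trace, the points satisfy [x ^+ (r * r) = x]
   and [h ^+ r = c - h].  The auxiliary polynomial [G = sum gam 'X^(l + a * r) h ^+ b]
   has its [r]-th power congruent there to
   [sum gam ^+ r 'X^(r * l + a) (c - h) ^+ b], which linear algebra makes vanish
   identically; [G] is nonzero because its terms have distinct degrees. *)
Lemma stepanov m c (s : seq K) : uniq s ->
  (forall x, x \in s -> x ^+ (p ^ m.+1 * p ^ m.+1) = x /\
     (half_trace m.+1).[x] + (half_trace m.+1).[x] ^+ (p ^ m.+1) = c) ->
  (size s <= p ^ m * p ^ m.+1 + 2 * d * p ^ m.+1)%N.
Proof.
move=> us sP.
set h := half_trace m.+1 in sP *; set r := (p ^ m.+1)%N in sP *; set rho := (p ^ m)%N.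
have rE : r = (p * rho)%N by rewrite /r expnS.
have rho0 : (0 < rho)%N by rewrite expn_gt0 p0.
have p2 : (1 < p)%N by rewrite prime_gt1 ?(pcharf_prime pK).
have szh : size h = (d * rho).+1 by rewrite size_half_trace.
have szch : size (c%:P - h) = (d * rho).+1.
  rewrite addrC size_polyDl size_polyN ?szh //.
  by rewrite (leq_ltn_trans (size_polyC_leq1 _)) // ltnS muln_gt0 d0.
pose T := ('I_(rho + d) * 'I_p * 'I_rho)%type.
pose P (t : T) : {poly K} := 'X^(r * t.2 + t.1.1) * (c%:P - h) ^+ t.1.2.
pose Q (t : T) : {poly K} := 'X^(t.2 + t.1.1 * r) * h ^+ t.1.2.
have szXn n b (g : {poly K}) : size g = (d * rho).+1 ->
    size ('X^n * g ^+ b) = (n + b * (d * rho)).+1.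
  move=> szg; have g0 : g != 0 by rewrite -size_poly_gt0 szg.
  have szgb : size (g ^+ b) = (b * (d * rho)).+1.
    have := size_exp g b; rewrite szg /= mulnC => <-.
    by rewrite prednK // size_poly_gt0 expf_neq0.
  by rewrite mulrC size_mulXn ?expf_neq0 // szgb addnS.
have [t||beta [[t0 bt0] sb]] := @poly_lin_dep K T P
    (r * rho.-1 + (rho + d).-1 + p.-1 * (d * rho)).+1.
- rewrite /P szXn // ltnS !leq_add //.
  + by rewrite leq_mul2l; apply/orP; right; rewrite -ltnS prednK //.
  + by rewrite -ltnS prednK ?ltn_ord // addn_gt0 rho0.
  + by rewrite leq_mul2r; apply/orP; right; rewrite -ltnS prednK.
- rewrite !card_prod !card_ord rE.
  exact: stepanov_unknowns.
(* The linear relation has coefficients [beta]; [G] needs their [r]-th roots, which exist in the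
   closed field [K]. *)
have [gam gamE] : exists gam : T -> K, forall t, gam t ^+ r = beta t.
  have r0 : (0 < r)%N by rewrite expn_gt0 p0.
  have ex t : exists y : K, y ^+ r == beta t.
    have [y yE] := solve_monicpoly (fun i => if i == 0%N then beta t else 0) r0.
    exists y; rewrite yE; case: (r) r0 => // k _.
    by rewrite big_ord_recl big1 ?addr0 ?expr0 ?mulr1 // => i _; rewrite mul0r.
  by exists (fun t => xchoose (ex t)) => t; apply/eqP; exact: (xchooseP (ex t)).
pose G := \sum_t gam t *: Q t.
have G0 : G != 0.
  apply: poly_lin_indep.
  - move=> t; rewrite -size_poly_gt0 /Q szXn //.
  (* The degree is [l + (a * p + b * d) * rho]: reduction modulo [rho] gives [l], then reduction
     modulo [p] gives [b] because [0 < d < p], and [a] remains. *)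
  - move=> [[a b] l] [[a' b'] l']; rewrite /Q !szXn // => /succn_inj /=; rewrite rE => E.
    have El : l = l' :> nat.
      have : (l + (a * p + b * d) * rho = l' + (a' * p + b' * d) * rho)%N by lia.
      move/(congr1 (modn^~ rho)).
      by rewrite -(modnDmr l) -(modnDmr l') !modnMl !addn0 !modn_small.
    have Eab : (a * p + b * d = a' * p + b' * d)%N.
      apply/eqP; rewrite -(eqn_pmul2r rho0); apply/eqP; lia.
    have Eb : b = b' :> nat.
      have : (b * d = b' * d %[mod p])%N.
        move/(congr1 (modn^~ p)): Eab.
        by rewrite -(modnDml (a * p)) -(modnDml (a' * p)) !modnMl !add0n.
      have cop : coprime p d.
        by rewrite prime_coprime ?(pcharf_prime pK) // gtnNdvd.
      wlog le : b b' {Eab E} / (b' <= b)%N.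
        move=> W; case: (leqP b' b) => [|/ltnW] /W H //.
        by move=> /esym/H.
      move/eqP; rewrite eqn_mod_dvd ?leq_mul2r ?le ?orbT //.
      rewrite -mulnBl Gauss_dvdl // => /dvdn_leq.
      have := ltn_ord b; lia.
    have Ea : a = a' :> nat.
      by apply/eqP; rewrite -(eqn_pmul2r p0); apply/eqP; rewrite Eb in Eab; lia.
    by congr (_, _, _); apply: val_inj.
  - exists t0; apply: contraNneq bt0 => g0; rewrite -gamE g0 expr0n.
    by rewrite expn_eq0 eqn0Ngt p0.
have rootG : all (root G) s.
  apply/allP => x /sP [xr hx].
  suff Gr0 : G.[x] ^+ r == 0 by move: Gr0; rewrite expf_eq0 rootE => /andP[].
  have : (G.[x]) ^+ r = (\sum_t beta t *: P t).[x].
    rewrite /G !horner_sum frob_sum //; apply: eq_bigr => t _.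
    rewrite !hornerZ exprMn gamE /P /Q !hornerM !hornerXn !horner_exp !hornerD hornerN hornerC.
    rewrite exprMn -!exprM mulnDl -mulnA [(t.1.1 * _)%N]mulnC exprD (exprM x (r * r)) xr.
    rewrite [(t.1.2 * r)%N]mulnC (exprM h.[x] r) -hx [h.[x] + _]addrC addrK exprD.
    by rewrite [(t.2 * r)%N]mulnC.
  by rewrite sb horner0 => ->.
apply: ltnW; apply: (leq_trans (max_poly_roots G0 rootG us)).
have: (size G <= (rho.-1 + (rho + d).-1 * r + p.-1 * (d * rho)).+1)%N.
  apply: (leq_trans (size_sum _ _ _)); apply/bigmax_leqP => t _.
  apply: (leq_trans (size_scale_leq _ _)); rewrite /Q szXn // ltnS !leq_add //.
  + by rewrite -ltnS prednK.
  + by rewrite leq_mul2r; apply/orP; right; rewrite -ltnS prednK ?ltn_ord // addn_gt0 rho0.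
  + by rewrite leq_mul2r; apply/orP; right; rewrite -ltnS prednK.
move/leq_trans; apply.
by rewrite rE; exact: stepanov_degree.
Qed.

End Stepanov.

Lemma sum_bool_size (T : Type) (s : seq T) (b : pred T) :
  (\sum_(x <- s) b x)%N = size (filter b s).
Proof. by elim: s => [|x s IH]; rewrite ?big_nil ?big_cons //= IH; case: (b x). Qed.

(** * Finite subfields of [K] and Frobenius orbits *)

Section CharSum.
Variables (K : closedFieldType) (p : nat) (pK : p \in [pchar K]).
Let p_pr : prime p := pcharf_prime pK.
Let p0 : (0 < p)%N := prime_gt0 p_pr.
Let p1 : (1 < p)%N := prime_gt1 p_pr.

Lemma frob_inj i : injective (fun x : K => x ^+ (p ^ i)).
Proof.
move=> x y /eqP E; apply/eqP; rewrite -subr_eq0.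
have : (x - y + y) ^+ (p ^ i) == y ^+ (p ^ i) by rewrite subrK.
by rewrite frobD // addrC -subr_eq0 addrAC subrr add0r expf_eq0 expn_gt0 p0.
Qed.

Lemma natK_inj m n : (m < p)%N -> (n < p)%N -> m%:R = n%:R :> K -> m = n.
Proof.
move=> mp np E; wlog le : m n mp np E / (n <= m)%N.
  by move=> W; case: (leqP n m) => [|/ltnW] H; [apply: W | apply/esym/W].
have : (p %| m - n)%N by rewrite (dvdn_pcharf pK) natrB // E subrr.
by move=> /dvdn_leq; lia.
Qed.

Lemma frob_fixedP (x : K) : x ^+ p = x -> exists2 m, (m < p)%N & x = m%:R.
Proof.
move=> xp.
have sz : size ('X^p - 'X : {poly K}) = p.+1.
  by rewrite size_polyDl size_polyXn // size_polyN size_polyX ltnS.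
have q0 : ('X^p - 'X : {poly K}) != 0 by rewrite -size_poly_gt0 sz.
case: (boolP (x \in [seq m%:R | m <- iota 0 p])) => [/mapP[m]|xN].
  by rewrite mem_iota => /= mp ->; exists m.
have := max_poly_roots q0 (rs := x :: [seq m%:R | m <- iota 0 p]).
rewrite /= size_map size_iota sz ltnn => W; suff: false by []; apply: W.
  rewrite rootE !hornerE xp subrr eqxx /=; apply/allP => _ /mapP[m _ ->].
  by rewrite rootE !hornerE -(pFrobenius_autE pK) pFrobenius_aut_nat subrr.
rewrite xN map_inj_in_uniq ?iota_uniq // => m n.
by rewrite !mem_iota => /= mp np; apply: natK_inj.
Qed.

Lemma frob_roots n : {s : seq K | uniq s /\ size s = (p ^ n.+1)%N
  & forall x, (x \in s) = (x ^+ (p ^ n.+1) == x)}.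
Proof.
set q := (p ^ n.+1)%N; have q1 : (1 < q)%N by rewrite (ltn_exp2l 0).
have sz : size ('X^q - 'X : {poly K}) = q.+1.
  by rewrite size_polyDl size_polyXn // size_polyN size_polyX ltnS.
have [r rE] := closed_field_poly_normal ('X^q - 'X : {poly K}).
have lc : lead_coef ('X^q - 'X : {poly K}) = 1.
  by rewrite lead_coefDl ?lead_coefXn // size_polyN size_polyX size_polyXn.
rewrite lc scale1r in rE; exists r.
  split; last by apply/succn_inj; rewrite -sz rE size_prod_XsubC.
  (* The derivative of ['X^q - 'X] is [-1], as [q = 0] in [K], so the roots are distinct. *)
  rewrite -separable_prod_XsubC -rE unlock derivB derivX derivXn.
  rewrite -scaler_nat (_ : q%:R = 0) ?scale0r ?sub0r; last first.
    by rewrite /q expnS natrM (pcharf0 pK) mul0r.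
  by rewrite -[X in coprimep _ X]scaleN1r coprimepZr ?coprimep1 // oppr_eq0 oner_eq0.
by move=> x; rewrite -root_prod_XsubC -rE rootE !hornerE subr_eq0.
Qed.

(* the subfield of [K] with [p ^ n] elements; [Fq 0] is junk *)
Definition Fq n : seq K := if n is n'.+1 then s2val (frob_roots n') else [::].

Lemma Fq_uniq n : uniq (Fq n).
Proof. by case: n => // n; have [] := s2valP (frob_roots n). Qed.

Lemma size_Fq n : (0 < n)%N -> size (Fq n) = (p ^ n)%N.
Proof. by case: n => // n _; have [] := s2valP (frob_roots n). Qed.

Lemma mem_Fq n x : (0 < n)%N -> (x \in Fq n) = (x ^+ (p ^ n) == x).
Proof. by case: n => // n _; exact: (s2valP' (frob_roots n)). Qed.

Implicit Types (g h : {poly K}) (x : K).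
Local Notation phi := (pFrobenius_aut pK).
Definition frob_poly (h : {poly K}) := map_poly phi h.
(** Polynomials over [F_p] are represented as polynomials over [K] that Frobenius fixes, so that all
    finite fields involved are subsets of the single field [K]. *)
Definition frob_fixed (h : {poly K}) := frob_poly h == h.

Lemma frob_fixed_coef (h : {poly K}) : frob_fixed h -> forall i, h`_i ^+ p = h`_i.
Proof. by move=> /eqP hE i; rewrite -[in RHS]hE coef_map. Qed.

Lemma frob_fixedI (h : {poly K}) : (forall i, h`_i ^+ p = h`_i) -> frob_fixed h.
Proof. by move=> H; apply/eqP/polyP => i; rewrite coef_map /= pFrobenius_autE. Qed.

Lemma frob_fixedM g h : frob_fixed g -> frob_fixed h -> frob_fixed (g * h).
Proof. by rewrite /frob_fixed /frob_poly rmorphM /= => /eqP -> /eqP ->. Qed.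

Lemma frob_fixed_divl g h : g != 0 -> frob_fixed g -> frob_fixed (g * h) -> frob_fixed h.
Proof.
move=> g0 /eqP gE /eqP; rewrite /frob_poly rmorphM /= -/(frob_poly g) gE => /(mulfI g0) hE.
exact/eqP.
Qed.

Lemma frob_poly_prod (l : seq K) :
  frob_poly (\prod_(t <- l) ('X - t%:P)) = \prod_(t <- [seq t ^+ p | t <- l]) ('X - t%:P).
Proof.
rewrite /frob_poly rmorph_prod big_map; apply: eq_bigr => t _.
by rewrite rmorphB /= map_polyX map_polyC.
Qed.

Lemma frob_fixed_horner h x i : frob_fixed h -> h.[x] ^+ (p ^ i) = h.[x ^+ (p ^ i)].
Proof.
move=> /eqP hE; elim: i => [|i IH]; first by rewrite !expr1.
by rewrite expnSr !exprM IH -(pFrobenius_autE pK) -horner_map -/(frob_poly h) hE.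
Qed.

(* for [x] in the field with [p ^ n] elements, the characteristic polynomial of [x] over [F_p] *)
Definition orbit_poly n (x : K) : {poly K} := \prod_(t <- mkseq (fun i => x ^+ (p ^ i)) n) ('X - t%:P).

Lemma orbit_polyE n x : orbit_poly n x = \prod_(i < n) ('X - (x ^+ (p ^ i))%:P).
Proof. by rewrite /orbit_poly big_map -{1}[n]subn0 -/(index_iota 0 n) big_mkord. Qed.

Lemma orbit_poly_monic n x : orbit_poly n x \is monic.
Proof. exact: monic_prod_XsubC. Qed.

Lemma size_orbit_poly n x : size (orbit_poly n x) = n.+1.
Proof. by rewrite size_prod_XsubC size_mkseq. Qed.

(** Frobenius rotates the list of conjugates by one place, the last one returning to [x]. *)
Lemma orbit_poly_fixed n x : x ^+ (p ^ n) = x -> frob_fixed (orbit_poly n x).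
Proof.
case: n => [|n] xn.
  by rewrite /frob_fixed /frob_poly /orbit_poly big_nil rmorph1.
rewrite /frob_fixed /orbit_poly frob_poly_prod; apply/eqP.
apply: perm_big; rewrite -map_comp.
have -> : [seq ((fun t => t ^+ p) \o (fun i => x ^+ (p ^ i))) i | i <- iota 0 n.+1] =
   rcons (mkseq (fun i => x ^+ (p ^ i.+1)) n) x.
  have -> : rcons (mkseq (fun i => x ^+ (p ^ i.+1)) n) x =
     rcons (mkseq (fun i => x ^+ (p ^ i.+1)) n) (x ^+ (p ^ n.+1)) by rewrite xn.
  rewrite -[LHS]/(mkseq _ n.+1) -/(mkseq (fun i => x ^+ (p ^ i.+1)) n.+1) -mkseqS.
  by apply: eq_mkseq => i /=; rewrite -exprM -expnSr.
rewrite perm_rcons /mkseq /= expn0 expr1 perm_cons.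
by rewrite (iotaDl 1 0) -map_comp.
Qed.

Lemma orbit_polyD e n x : x ^+ (p ^ e) = x ->
  orbit_poly (e + n) x = orbit_poly e x * orbit_poly n x.
Proof.
move=> xe; rewrite !orbit_polyE big_split_ord /=; congr (_ * _).
by apply: eq_bigr => i _; rewrite expnD exprM xe.
Qed.

Lemma frob_fixed_root h x i : frob_fixed h -> root h x -> root h (x ^+ (p ^ i)).
Proof.
move=> hF /rootP hx; apply/rootP; rewrite -frob_fixed_horner // hx expr0n.
by rewrite expn_eq0 eqn0Ngt p0.
Qed.

(** The conjugates of [x] are roots of [h], hence finite in number; a repetition among them pulls
    back to [x] because Frobenius is injective. *)
Lemma root_period h x : h != 0 -> frob_fixed h -> root h x ->
  exists e, [/\ (0 < e)%N, x ^+ (p ^ e) = x & forall i, (0 < i < e)%N -> x ^+ (p ^ i) != x].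
Proof.
move=> h0 hF hx.
have ex : exists e, (0 < e)%N && (x ^+ (p ^ e) == x).
  have /(uniqPn 0)[i [j [ij]]] : ~~ uniq (mkseq (fun i => x ^+ (p ^ i)) (size h)).
    apply/negP => u; have := max_poly_roots h0 _ u; rewrite size_mkseq ltnn => W; suff: false by [].
    apply: W; by apply/allP => _ /mapP[i _ ->]; apply: frob_fixed_root.
  rewrite size_mkseq => jh.
  rewrite !nth_mkseq //; last exact: ltn_trans jh.
  move=> E; exists (j - i)%N; rewrite subn_gt0 ij /=; apply/eqP.
  apply: (@frob_inj i); rewrite -exprM -expnD subnK //; exact: ltnW.
case: (ex_minnP ex) => e /andP[e0 /eqP xe] emin; exists e; split=> // i /andP[i0 ie].
by apply: contraTneq ie => xi; rewrite -leqNgt; apply: emin; rewrite i0 xi eqxx.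
Qed.

(** If [e] is the exact period of [x], only multiples [j] of [e] contribute, and then
    [orbit_poly j x] is the power [j / e] of the minimal polynomial [orbit_poly e x]. The sum thus
    counts the powers of the minimal polynomial that divide [h]; the induction divides one off. *)
Lemma frob_fixed_mup k h x : h \is monic -> frob_fixed h -> size h = k.+1 ->
  (\sum_(1 <= j < k.+1) ((x ^+ (p ^ j) == x)%R && (orbit_poly j x %| h)%R : nat))%N = mup x h.
Proof.
elim/ltn_ind: k h => k IH h hm hF hk.
have h0 : h != 0 by rewrite monic_neq0.
case: (boolP (root h x)) => [hx|hx]; last first.
  rewrite mupNroot // big_nat big1 // => j /andP[j0 _].
  case: (boolP (orbit_poly j x %| h)) => [dv|]; last by rewrite andbF.
  case/negP: hx; rewrite -dvdp_XsubCl; apply: dvdp_trans dv.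
  rewrite dvdp_XsubCl root_prod_XsubC; apply/mapP; exists 0%N; last by rewrite expr1.
  by rewrite mem_iota.
have [e [e0 xe emin]] := root_period h0 hF hx.
have Nroots : uniq (mkseq (fun i => x ^+ (p ^ i)) e).
  apply/(mkseq_uniqP (fun i => x ^+ (p ^ i)) e) => i j; rewrite !inE => ie je E.
  wlog ij : i j ie je E / (i <= j)%N.
    by move=> W; case: (leqP i j) => [|/ltnW] H; [apply: W | apply/esym/W].
  apply/eqP; case: (ltngtP i j) ij => // ij _.
  have := emin (j - i)%N; rewrite subn_gt0 ij /= => /(_ _) /negP[|]; first by lia.
  by apply/eqP/(@frob_inj i); rewrite -exprM -expnD subnK //; exact: ltnW.
have dvN : orbit_poly e x %| h.
  apply: uniq_roots_dvdp; last by rewrite uniq_rootsE.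
  by apply/allP => _ /mapP[i _ ->]; apply: frob_fixed_root.
have /dvdpP[g] := dvN; rewrite mulrC => hE.
have N0 : orbit_poly e x != 0 by rewrite monic_neq0 ?orbit_poly_monic.
have gm : g \is monic by move: hm; rewrite hE monicMl ?orbit_poly_monic.
have gF : frob_fixed g.
  by apply: (frob_fixed_divl N0 (orbit_poly_fixed xe)); rewrite -hE.
have g0 : g != 0 by rewrite monic_neq0.
have sg : (size g = (k - e).+1 /\ e <= k)%N.
  have gp : (0 < size g)%N by rewrite size_poly_gt0.
  have E : k.+1 = (e + size g)%N by rewrite -hk hE size_mul // size_orbit_poly.
  by move: gp E; clear; lia.
case: sg => sg ek.
rewrite hE mupM // mu_prod_XsubC count_uniq_mem //.
have -> : x \in mkseq (fun i => x ^+ (p ^ i)) e.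
  by apply/mapP; exists 0%N; rewrite ?mem_iota ?expr1.
rewrite -(IH (k - e)%N _ g) //; last by move: e0 ek; clear; lia.
(* Indices below [e] contribute nothing, [e] contributes one, and a shift by [e] turns the rest into
   the sum for the quotient [g]. *)
rewrite (big_cat_nat (n := e)) //=; last by rewrite ltnW.
rewrite big_nat big1 ?add0n => [|j /andP[j0 je]]; last first.
  by rewrite (negPf (emin j _)) // j0.
rewrite big_ltn //.
rewrite xe eqxx dvdp_mulr //=; congr (1 + _)%N.
rewrite -[e.+1]addn1 addnC -{1}[in X in index_iota _ X](subnK ek) -addSn big_addn.
rewrite addnK; apply: eq_bigr => j _.
rewrite addnC expnD exprM xe orbit_polyD // dvdp_mul2l //.
Qed.

Definition proots (h : {poly K}) : seq K := sval (closed_field_poly_normal h).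

Lemma prootsE h : h \is monic -> h = \prod_(t <- proots h) ('X - t%:P).
Proof.
rewrite /proots; case: (closed_field_poly_normal h) => r /= rE /monicP hm.
by rewrite rE hm scale1r.
Qed.

Lemma size_proots h k : h \is monic -> size h = k.+1 -> size (proots h) = k.
Proof. by move=> hm; rewrite {1}(prootsE hm) size_prod_XsubC => -[]. Qed.

(* A root of [h] of multiplicity [v] accounts for exactly [v] of the pairs [(j, x)];
   this replaces the Euler product of the L-function. *)
Lemma count_orbit_poly k h : h \is monic -> frob_fixed h -> size h = k.+1 ->
  (\sum_(1 <= j < k.+1) \sum_(x <- Fq j) (orbit_poly j x %| h)%R = k)%N.
Proof.
move=> hm hF hk; set r := proots h.
have hE : h = \prod_(t <- r) ('X - t%:P) by exact: prootsE.
have rk : size r = k by exact: size_proots.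
(* For [j > 0], [x] is itself a root of [orbit_poly j x], so only roots of [h] count and the two
   sums can be exchanged. *)
transitivity (\sum_(1 <= j < k.+1) \sum_(x <- undup r)
    ((x ^+ (p ^ j) == x)%R && (orbit_poly j x %| h)%R : nat))%N.
  apply: eq_big_nat => j /andP[j0 jk].
  rewrite !sum_bool_size; apply: perm_size; apply: uniq_perm; rewrite ?filter_uniq ?undup_uniq ?Fq_uniq //.
  move=> x; rewrite !mem_filter mem_Fq // mem_undup.
  case: (boolP (orbit_poly j x %| h)) => //= dv; last by rewrite andbF.
  rewrite andbT; case: eqP => //= _.
  apply/esym; rewrite -root_prod_XsubC -hE -dvdp_XsubCl; apply: dvdp_trans dv.
  rewrite dvdp_XsubCl root_prod_XsubC; apply/mapP; exists 0%N; last by rewrite expr1.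
  by rewrite mem_iota.
rewrite exchange_big /=.
transitivity (\sum_(x <- undup r) count_mem x r)%N.
  by apply: eq_bigr => x _; rewrite frob_fixed_mup // hE mu_prod_XsubC.
rewrite -[RHS]rk -sum1_size -[RHS]big_undup_iterop_count; apply: eq_bigr => x _.
by rewrite Monoid.iteropE iter_addn_0 mul1n.
Qed.
End CharSum.

(** * Monic polynomials over the prime field *)

Section MonicFixed.
Variables (K : closedFieldType) (p : nat) (pK : p \in [pchar K]).
Let p_pr : prime p := pcharf_prime pK.
Let p0 : (0 < p)%N := prime_gt0 p_pr.
Let p1 : (1 < p)%N := prime_gt1 p_pr.

Definition monic_of k (c : {ffun 'I_k -> 'I_p}) : {poly K} :=
  'X^k + \poly_(i < k) (if insub i is Some j then (c j)%:R else 0).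

Lemma coef_monic_of k (c : {ffun 'I_k -> 'I_p}) (j : 'I_k) : (monic_of c)`_j = (c j)%:R.
Proof.
by rewrite coefD coefXn coef_poly ltn_ord valK (ltn_eqF (ltn_ord j)) add0r.
Qed.

Lemma size_monic_of k (c : {ffun 'I_k -> 'I_p}) : size (monic_of c) = k.+1.
Proof. by rewrite size_polyDl size_polyXn // ltnS size_poly. Qed.

Lemma monic_of_monic k (c : {ffun 'I_k -> 'I_p}) : monic_of c \is monic.
Proof.
rewrite monicE lead_coefE size_monic_of coefD coefXn eqxx /= coef_poly ltnn.
by rewrite addr0.
Qed.

Definition monics k : seq {poly K} := [seq monic_of c | c : {ffun 'I_k -> 'I_p}].

Lemma monics_uniq k : uniq (monics k).
Proof.
rewrite map_inj_uniq ?enum_uniq // => c c' E; apply/ffunP => j; apply: ord_inj.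
apply: (natK_inj pK) => //; by rewrite -!coef_monic_of E.
Qed.

Lemma mem_monics k (h : {poly K}) :
  (h \in monics k) = [&& h \is monic, size h == k.+1 & frob_fixed pK h].
Proof.
apply/mapP/and3P => [[c _ ->]|[hm /eqP hk hF]].
  rewrite monic_of_monic size_monic_of; split=> //.
  apply/frob_fixedI => i.
  case: (ltngtP i k) => ik.
  - by rewrite (coef_monic_of c (Ordinal ik)) -(pFrobenius_autE pK) pFrobenius_aut_nat.
  - by rewrite nth_default ?expr0n ?eqn0Ngt ?p0 // size_monic_of.
  - rewrite ik; have /monicP := monic_of_monic c; rewrite lead_coefE size_monic_of /= => ->.
    by rewrite expr1n.
have ex (i : 'I_k) : exists m : 'I_p, m%:R == h`_i.
  have [m mp mE] := frob_fixedP pK (frob_fixed_coef hF i).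
  by exists (Ordinal mp); rewrite mE.
exists [ffun i => xchoose (ex i)]; first by rewrite mem_enum.
apply/polyP => i; case: (ltngtP i k) => ik.
- rewrite (coef_monic_of _ (Ordinal ik)) ffunE.
  by have /eqP -> := xchooseP (ex (Ordinal ik)).
- by rewrite !nth_default // ?size_monic_of ?hk.
- rewrite ik; set g := monic_of _.
  have /monicP := monic_of_monic [ffun i => xchoose (ex i)].
  rewrite lead_coefE size_monic_of /= -/g => ->.
  by move/monicP: hm; rewrite lead_coefE hk.
Qed.

(** Reindexing by the cofactor; this produces the convolution in [Asum_newton]. *)
Lemma monics_dvd k j x : (j <= k)%N -> x ^+ (p ^ j) = x ->
  perm_eq [seq h <- monics k | orbit_poly p j x %| h]
          [seq orbit_poly p j x * g | g <- monics (k - j)].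
Proof.
move=> jk xj; have N0 : orbit_poly p j x != 0 by rewrite monic_neq0 ?orbit_poly_monic.
apply: uniq_perm; first by rewrite filter_uniq ?monics_uniq.
  by rewrite map_inj_uniq ?monics_uniq //; apply: mulfI.
move=> h; rewrite mem_filter mem_monics; apply/andP/mapP.
  move=> [/dvdpP[g ->]] /and3P[]; rewrite mulrC => gm /eqP gs gF; exists g => //.
  have gm' : g \is monic by rewrite monicMl ?orbit_poly_monic in gm.
  rewrite mem_monics gm' (frob_fixed_divl N0 (orbit_poly_fixed pK xj)) // andbT.
  rewrite size_mul ?(monic_neq0 gm) ?(monic_neq0 gm') // size_orbit_poly in gs.
  have gs' : (j + size g)%N = k.+1 := gs.
  by apply/eqP; rewrite -subSn // -gs' addKn.
move=> [g]; rewrite mem_monics => /and3P[gm /eqP gs gF] ->; split; first exact: dvdp_mulr.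
rewrite monicMl ?orbit_poly_monic // gm frob_fixedM ?orbit_poly_fixed // andbT /=.
rewrite size_mul ?(monic_neq0 gm) // size_orbit_poly gs addSn /= addnS subnKC //.
Qed.

End MonicFixed.

(** * The multiplicative character [lam] and its L-function *)

Section Character.
Variables (K : closedFieldType) (p : nat) (pK : p \in [pchar K]).
Let p_pr : prime p := pcharf_prime pK.
Let p0 : (0 < p)%N := prime_gt0 p_pr.
Variables (C : comNzRingType) (z : C) (zp : p.-primitive_root z).

(* the additive character [m |-> z ^+ m] of the prime field; junk elsewhere *)
Definition psi (x : K) : C := z ^+ find (fun k => k%:R == x) (iota 0 p).

Lemma psi_nat m : psi m%:R = z ^+ m.
Proof.
rewrite /psi; set P := fun k => _.
have mp : (m %% p < p)%N by rewrite ltn_mod.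
have hP : has P (iota 0 p).
  by apply/hasP; exists (m %% p)%N; rewrite ?mem_iota // /P (GRing.natr_mod_pchar pK).
have := nth_find 0%N hP; rewrite /P nth_iota; last by move: hP; rewrite has_find size_iota.
rewrite add0n => /eqP E.
rewrite -[in RHS](prim_expr_mod zp); congr (z ^+ _); apply: (natK_inj pK) => //.
  by move: hP; rewrite has_find size_iota.
by rewrite (GRing.natr_mod_pchar pK).
Qed.

Lemma psiD x y : x ^+ p = x -> y ^+ p = y -> psi (x + y) = psi x * psi y.
Proof.
move=> /(frob_fixedP pK)[m _ ->] /(frob_fixedP pK)[n _ ->].
by rewrite -natrD !psi_nat exprD.
Qed.

Lemma psi_eq1 x : x ^+ p = x -> psi x = 1 -> x = 0.
Proof.
move=> /(frob_fixedP pK)[m _ ->]; rewrite psi_nat => /eqP.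
by rewrite -(prim_order_dvd zp) (dvdn_pcharf pK) => /eqP.
Qed.

Variables (F : {poly K}) (FF : frob_fixed pK F).

Definition root_sum (l : seq K) : K := \sum_(t <- l) F.[t].
(** A completely multiplicative function on monic polynomials over [F_p]; at [orbit_poly n x] its
    value is the character of the trace of [F.[x]]. *)
Definition lam (h : {poly K}) : C := psi (root_sum (proots h)).

Lemma lam_prod (l : seq K) : lam (\prod_(t <- l) ('X - t%:P)) = psi (root_sum l).
Proof.
rewrite /lam; congr psi; apply: perm_big; apply: prod_XsubC_eq.
by rewrite -prootsE // monic_prod_XsubC.
Qed.

(** Frobenius permutes the roots of a polynomial over the prime field, so the argument of [psi]
    stays where [psi] is additive. *)
Lemma root_sum_fixed (l : seq K) : frob_fixed pK (\prod_(t <- l) ('X - t%:P)) ->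
  root_sum l ^+ p = root_sum l.
Proof.
rewrite /frob_fixed frob_poly_prod => /eqP /prod_XsubC_eq E.
rewrite -{1}[p]expn1 frob_sum // -[RHS](perm_big _ E) big_map.
by apply: eq_bigr => t _; rewrite expn1 -{1}[p]expn1 frob_fixed_horner // expn1.
Qed.

Lemma lamM g h : g \is monic -> h \is monic -> frob_fixed pK g -> frob_fixed pK h ->
  lam (g * h) = lam g * lam h.
Proof.
move=> /prootsE gE /prootsE hE gF hF.
have {1}-> : g * h = \prod_(t <- proots g ++ proots h) ('X - t%:P).
  by rewrite big_cat /= -gE -hE.
rewrite lam_prod /root_sum big_cat /= psiD //.
- by apply: root_sum_fixed; rewrite -gE.
- by apply: root_sum_fixed; rewrite -hE.
Qed.

(* [Ssum n] is the exponential sum over the field with [p ^ n] elements, and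
   [Asum k] the coefficient of degree [k] of its L-function. *)
Definition Ssum n : C := \sum_(x <- Fq pK n) psi (\sum_(i < n) F.[x] ^+ (p ^ i)).
Definition Asum k : C := \sum_(h <- monics K p k) lam h.

Lemma lam_orbit n x : lam (orbit_poly p n x) = psi (\sum_(i < n) F.[x] ^+ (p ^ i)).
Proof.
rewrite /orbit_poly lam_prod /root_sum big_map -{1}[n]subn0 -/(index_iota 0 n) big_mkord.
by congr psi; apply: eq_bigr => i _; rewrite (frob_fixed_horner _ _ FF).
Qed.

Lemma Asum0 : Asum 0 = 1.
Proof.
rewrite /Asum (perm_big [:: 1]) /=.
  rewrite big_seq1; have := lam_prod [::]; rewrite /root_sum !big_nil => ->.
  by rewrite -[0 in LHS](mulr0n 1) psi_nat.
apply: uniq_perm; rewrite ?monics_uniq // => h; rewrite (mem_monics pK) inE.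
apply/and3P/eqP => [[hm /eqP hs _]|->].
  have /size_poly1P[c c0 hE] : size h == 1%N by rewrite hs.
  by move/monicP: hm; rewrite hE lead_coefC => ->.
by rewrite monic1 size_poly1 /frob_fixed /frob_poly rmorph1.
Qed.

(** The logarithmic derivative of the L-function. The factor [k] is the number of pairs in
    [count_orbit_poly], and each pair [(j, x)] splits [h] into [orbit_poly j x] and a monic
    cofactor, over which [lam] factors. *)
Lemma Asum_newton k : Asum k *+ k = \sum_(i < k) Ssum i.+1 * Asum (k - i.+1).
Proof.
transitivity (\sum_(1 <= j < k.+1) \sum_(x <- Fq pK j) \sum_(h <- monics K p k)
   lam h *+ (orbit_poly p j x %| h)%R).
  under eq_bigr do rewrite exchange_big /=.
  rewrite exchange_big /= /Asum -sumrMnl; apply: eq_big_seq => h.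
  rewrite (mem_monics pK) => /and3P[hm /eqP hs hF].
  rewrite -{1}(count_orbit_poly hm hF hs) -sumrMnr; apply: eq_bigr => j _.
  by rewrite -sumrMnr.
rewrite big_add1 /= big_mkord; apply: eq_bigr => -[j jk] _ /=.
rewrite /Ssum mulr_suml; apply: eq_big_seq => x; rewrite -/(Fq pK j.+1) mem_Fq // => /eqP xj.
under eq_bigr do rewrite mulrb.
rewrite -big_mkcond -big_filter (perm_big _ (monics_dvd pK jk xj)) big_map.
rewrite /Asum mulr_sumr; apply: eq_big_seq => h.
rewrite (mem_monics pK) => /and3P[hm _ hF].
by rewrite lamM ?orbit_poly_monic ?orbit_poly_fixed // lam_orbit.
Qed.

Variables (d : nat) (szF : size F = d.+1) (d0 : (0 < d)%N) (dp : (d < p)%N).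

Lemma monic_coef_esgn (h : {poly K}) k j : h \is monic -> size h = k.+1 -> (j <= k)%N ->
  (esgn (proots h))`_j = h`_(k - j).
Proof.
move=> hm hs jk; rewrite coef_esgn ?(size_proots hm hs) //.
by rewrite -prootsE.
Qed.

(* By Newton's identities only the power sum of degree [d] sees the coefficient of ['X^(k - d)]. *)
Lemma psum_shift (h : {poly K}) k : h \is monic -> size h = k.+1 -> (d <= k)%N ->
  forall j, (j <= d)%N ->
  psum (proots (h + 'X^(k - d))) j = psum (proots h) j - (if j == d then d%:R else 0).
Proof.
move=> hm hs dk.
set h' := h + _.
have szX : (size ('X^(k - d) : {poly K}) < size h)%N.
  by rewrite size_polyXn hs; move: d0 dk; clear; lia.
have hs' : size h' = k.+1 by rewrite size_polyDl.
have hm' : h' \is monic by rewrite monicE lead_coefDl // -monicE.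
have eE j : (j <= d)%N -> (esgn (proots h'))`_j = (esgn (proots h))`_j + (j == d)%:R.
  move=> jd; rewrite !(@monic_coef_esgn _ k) ?(leq_trans jd) // coefD coefXn.
  by congr (_ + _%:R); rewrite (_ : (k - j == k - d)%N = (j == d)) //; move: jd dk; clear; lia.
elim/ltn_ind => j IH jd.
case: j IH jd => [|j] IH jd.
  rewrite eq_sym eqn0Ngt d0 subr0 /psum.
  under eq_bigr do rewrite expr0.
  under [in RHS]eq_bigr do rewrite expr0.
  by rewrite !big_const_seq !count_predT !(size_proots (k := k)).
have e0 (l : seq K) : (esgn l)`_0 = 1.
  elim: l => [|t l IHl]; first by rewrite /esgn big_nil coef1.
  by rewrite esgn_cons subr0.
have := newton_psum (proots h') j.+1; have := newton_psum (proots h) j.+1.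
rewrite !big_ord_recr /= !subnn !e0 !mulr1.
have -> : \sum_(i < j) psum (proots h') i.+1 * (esgn (proots h'))`_(j.+1 - i.+1) =
          \sum_(i < j) psum (proots h) i.+1 * (esgn (proots h))`_(j.+1 - i.+1).
  apply: eq_bigr => -[i ij] _ /=.
  rewrite IH ?ltnS //; last by move: ij jd; clear; lia.
  rewrite eE; last by move: jd; clear; lia.
  rewrite !ifN ?subr0; last by move: ij jd; clear; lia.
  rewrite (_ : _ == d = false) ?addr0 //; move: ij jd; clear; lia.
set s := \sum_(i < j) _; rewrite eE //.
(* At index [d] the coefficient has grown by one, so the left side of Newton's identity grows by [d]
   and the power sum drops by [d]. *)
case: eqP => [->|_]; last by rewrite addr0 subr0 => -> /oppr_inj /addrI ->.
set a := psum (proots h') d; set b := psum (proots h) d => E.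
rewrite mulrnDl E => E2; have -> : a = - (- (s + a)) - s by ring.
rewrite -E2 [true%:R]mulr1n; ring.
Qed.

Lemma root_sum_psum l : root_sum l = \sum_(i < d.+1) F`_i * psum l i.
Proof.
rewrite /root_sum; under eq_bigr do rewrite horner_coef szF.
by rewrite exchange_big; apply: eq_bigr => i _; rewrite mulr_sumr.
Qed.

(** Adding ['X^(k - d)] permutes the monic polynomials of degree [k] and multiplies every [lam] by
    the same constant. As [C] is only a ring here, the hypothesis that this constant differs from
    [1] takes the form of regularity of the difference. *)
Lemma Asum_eq0 : GRing.lreg (psi (- (d%:R * F`_d)) - 1) -> forall k, (d <= k)%N -> Asum k = 0.
Proof.
move=> reg k dk.
have dF : (- (d%:R * F`_d)) ^+ p = - (d%:R * F`_d).
  rewrite -(pFrobenius_autE pK) rmorphN rmorphM rmorph_nat /= pFrobenius_autE.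
  by rewrite frob_fixed_coef.
have hP h : h \in monics K p k -> lam (h + 'X^(k - d)) = psi (- (d%:R * F`_d)) * lam h.
  rewrite (mem_monics pK) => /and3P[hm /eqP hs hF].
  rewrite /lam -psiD //; last by apply: root_sum_fixed; rewrite -prootsE.
  congr psi; rewrite !root_sum_psum [in LHS]big_ord_recr [in RHS]big_ord_recr /=.
  rewrite (psum_shift hm hs dk (leqnn d)) eqxx mulrBr.
  rewrite (eq_bigr (fun i : 'I_d => F`_i * psum (proots h) i)) => [|i _]; first by ring.
  rewrite (psum_shift hm hs dk (ltnW (ltn_ord i))) ifN ?subr0 //.
  by rewrite neq_ltn ltn_ord.
have E : psi (- (d%:R * F`_d)) * Asum k = Asum k.
  rewrite /Asum mulr_sumr; under eq_big_seq do rewrite -hP //.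
  rewrite -(big_map (fun h => h + 'X^(k - d)) predT lam); apply: perm_big.
  have injA : injective (fun h : {poly K} => h + 'X^(k - d)) by apply: addIr.
  have sub : {subset [seq h + 'X^(k - d) | h <- monics K p k] <= monics K p k}.
    move=> _ /mapP[h hM ->]; move: hM; rewrite !(mem_monics pK) => /and3P[hm /eqP hs hF].
    have szX : (size ('X^(k - d) : {poly K}) < size h)%N.
      by rewrite size_polyXn hs; move: d0 dk; clear; lia.
    rewrite monicE lead_coefDl // -monicE hm size_polyDl // hs eqxx /=.
    apply: frob_fixedI => i; rewrite coefD coefXn -(pFrobenius_autE pK) rmorphD rmorph_nat /=.
    by rewrite pFrobenius_autE frob_fixed_coef.
  have u : uniq [seq h + 'X^(k - d) | h <- monics K p k].
    by rewrite map_inj_uniq // monics_uniq.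
  apply: uniq_perm => //; first exact: monics_uniq.
  by have [|_ e] := uniq_min_size u sub; rewrite ?size_map.
by apply: reg; rewrite mulr0 mulrBl mul1r E subrr.
Qed.

End Character.

(** * Moduli of numbers from the growth of their power sums *)

Section Growth.
Variables (C : numClosedFieldType).
Hypothesis archi : forall x : C, exists n : nat, `|x| < n%:R.

Lemma bernoulli (e : C) n : 0 <= e -> 1 + n%:R * e <= (1 + e) ^+ n.
Proof.
move=> e0; elim: n => [|n IH]; first by rewrite mul0r addr0 expr0.
rewrite exprS; apply: le_trans (_ : (1 + e) * (1 + n%:R * e) <= _); last first.
  by rewrite ler_wpM2l // addr_ge0.
have -> : (1 + e) * (1 + n%:R * e) = 1 + n.+1%:R * e + n%:R * e * e by rewrite -natr1; ring.
by rewrite lerDl !mulr_ge0.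
Qed.

(* A polynomial vanishing at the other entries of [l] isolates the contribution of [t]. *)
Lemma psum_growth (l : seq C) (B b : C) : 0 < b ->
  (forall m, `|psum l m.+1| <= B * b ^+ m.+1) -> forall t, t \in l -> `|t| <= b.
Proof.
move=> b0 bnd t tl; rewrite real_leNgt ?normr_real ?gtr0_real //; apply/negP => bt.
pose Q : {poly C} := \prod_(u <- [seq u <- l | u != t]) ('X - u%:P).
have Qt : Q.[t] != 0.
  by rewrite -[_ != 0]/(~~ root Q t) root_prod_XsubC mem_filter eqxx.
have ct : 0 < (count_mem t l)%:R :> C by rewrite ltr0n -has_count has_pred1.
have sumQ m : \sum_(u <- l) u ^+ m * Q.[u] = (count_mem t l)%:R * (t ^+ m * Q.[t]).
  rewrite (bigID (pred1 t)) /= [X in _ + X]big1_seq ?addr0.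
    rewrite -big_filter (eq_big_seq (fun=> t ^+ m * Q.[t])) => [|u].
      by rewrite big_const_seq count_predT size_filter iter_addr_0 mulr_natl.
    by rewrite mem_filter => /andP[/eqP -> _].
  move=> u /andP[ut ul]; apply/eqP; rewrite mulf_eq0; apply/orP; right.
  by rewrite -/(root Q u) root_prod_XsubC mem_filter ut.
pose D := \sum_(k < size Q) `|Q`_k| * (B * b ^+ k).
(* Expanding [Q] into monomials gives power sums with index shifted by [k]; the shifts are absorbed
   in the constant [D]. *)
have key m : (count_mem t l)%:R * (`|t| ^+ m.+1 * `|Q.[t]|) <= D * b ^+ m.+1.
  rewrite -normrX -normrM -[X in X * _]normr_nat -normrM -sumQ.
  under eq_bigr do rewrite horner_coef mulr_sumr.
  rewrite exchange_big /= mulr_suml; apply: le_trans (ler_norm_sum _ _ _) _.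
  apply: ler_sum => k _.
  have -> : \sum_(u <- l) u ^+ m.+1 * (Q`_k * u ^+ k) = Q`_k * psum l (k + m).+1.
    rewrite /psum mulr_sumr; apply: eq_bigr => u _.
    by rewrite mulrCA -exprD addSn addnC.
  rewrite normrM -!mulrA ler_wpM2l //; apply: le_trans (bnd _) _.
  by rewrite -addnS exprD.
(* The ratio [y] exceeds [1] while its powers stay below [D'], against Bernoulli's inequality and
   the Archimedean property. *)
pose y := `|t| / b; pose D' := D / ((count_mem t l)%:R * `|Q.[t]|).
have cQ : 0 < (count_mem t l)%:R * `|Q.[t]| by rewrite mulr_gt0 // normr_gt0.
have key2 m : y ^+ m.+1 <= D'.
  rewrite /y expr_div_n ler_pdivlMr // mulrAC ler_pdivrMr ?exprn_gt0 //.
  by rewrite (mulrC (_ ^+ _)) -mulrA (mulrC `|_|).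
have y1 : 0 < y - 1 by rewrite subr_gt0 /y ltr_pdivlMr ?mul1r.
have D0 : 0 <= D' by apply: le_trans (key2 0%N); rewrite exprn_ge0 // divr_ge0 // ltW.
have [n] := archi (D' / (y - 1)).
have -> : `|D' / (y - 1)| = D' / (y - 1) by rewrite ger0_norm // divr_ge0 // ltW.
rewrite ltr_pdivrMr // => nP.
have : D' < D'.
  apply: lt_le_trans nP _; apply: le_trans (key2 n).
  have := bernoulli n.+1 (ltW y1); rewrite addrCA subrr addr0; apply: le_trans.
  by rewrite ler_wpDl // ler_wpM2r ?(ltW y1) // ler_nat.
by rewrite ltxx.
Qed.
End Growth.

(** * Weil's inequality *)

Section Weil.
Variables (K : closedFieldType) (p : nat) (pK : p \in [pchar K]).
Let p_pr : prime p := pcharf_prime pK.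
Let p0 : (0 < p)%N := prime_gt0 p_pr.
Variables (C : numClosedFieldType) (z : C) (zp : p.-primitive_root z).
Hypothesis archi : forall x : C, exists n : nat, `|x| < n%:R.
Variables (F : {poly K}) (FF : frob_fixed pK F).
Variables (d : nat) (szF : size F = d.+1) (d0 : (0 < d)%N) (dp : (d < p)%N).

Let z1 : `|z| = 1.
Proof.
apply/eqP; rewrite -(@pexpr_eq1 _ _ p) // ?ltW // -normrX (prim_expr_order zp).
by rewrite normr1.
Qed.

Let sumz0 : \sum_(c < p) z ^+ c = 0.
Proof.
apply/eqP; have /eqP : (z - 1) * \sum_(c < p) z ^+ c = 0.
  by rewrite -subrX1 (prim_expr_order zp) subrr.
rewrite mulf_eq0 subr_eq0 => /orP[/eqP E|//].
have := prim_order_dvd zp 1; rewrite expr1 E eqxx dvdn1.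
by move/eqP => E1; have := prime_gt1 p_pr; rewrite E1.
Qed.

(** [Z c] counts the points of trace [c], and [stepanov] bounds it by [B] for every [c]. As the
    powers of [z] sum to zero, [Z c] may be replaced by [Z c - B], all of one sign, so the modulus
    is at most [p * B - p ^ n = 2 * d * p * r]. *)
Lemma Ssum_even_bound m :
  `|Ssum pK z F (m.+1 + m.+1)| <= (2 * d * p)%:R * p%:R ^+ m.+1.
Proof.
set n := (m.+1 + m.+1)%N; set r := (p ^ m.+1)%N.
pose G x := \sum_(i < n) F.[x] ^+ (p ^ i).
have Gfix x : x \in Fq pK n -> G x ^+ p = G x.
  rewrite mem_Fq // => /eqP xn.
  have yn : F.[x] ^+ (p ^ n) = F.[x] by rewrite (frob_fixed_horner _ _ FF) xn.
  rewrite -{1}[p]expn1 /G frob_sum // expn1 /n addSn big_ord_recr [in RHS]big_ord_recl /=.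
  rewrite -exprM -expnSr -addSn -/n yn expn0 expr1 addrC; congr (_ + _).
  by apply: eq_bigr => i _; rewrite -exprM -expnSr.
pose Z (c : 'I_p) := count (fun x => G x == c%:R) (Fq pK n).
pose B := (p ^ m * r + 2 * d * r)%N.
have ZB c : (Z c <= B)%N.
  rewrite /Z -size_filter; apply: (stepanov pK szF d0 dp (c := c%:R)).
    by rewrite filter_uniq ?Fq_uniq.
  move=> x; rewrite mem_filter mem_Fq // => /andP[/eqP GE /eqP xn]; split.
    by rewrite -expnD.
  rewrite /half_trace horner_sum frob_sum // -GE /G /n big_split_ord /=.
  congr (_ + _); apply: eq_bigr => i _; rewrite horner_exp //.
  by rewrite -exprM -expnD addnC.
have SE : Ssum pK z F n = \sum_(c < p) z ^+ c * (Z c)%:R.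
  transitivity (\sum_(x <- Fq pK n) \sum_(c < p) z ^+ c * (G x == c%:R)%:R).
    apply: eq_big_seq => x /Gfix /(frob_fixedP pK)[c cp GE].
    rewrite -/(G x) GE (psi_nat pK zp) (bigD1 (Ordinal cp)) //= eqxx mulr1 big1 ?addr0 //.
    move=> c' c'c; case: eqP => [E|]; last by rewrite mulr0.
    by case/eqP: c'c; apply: ord_inj; rewrite /=; apply: (natK_inj pK).
  rewrite exchange_big; apply: eq_bigr => c _; rewrite -mulr_sumr; congr (_ * _).
  by rewrite -natr_sum sum_bool_size size_filter.
have Zsum : (\sum_(c < p) Z c = p ^ n)%N.
  rewrite -(size_Fq pK (n := n)) //.
  transitivity (\sum_(c < p) \sum_(x <- Fq pK n) (G x == c%:R))%N.
    by apply: eq_bigr => c _; rewrite sum_bool_size size_filter.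
  rewrite -sum1_size exchange_big /=; apply: eq_big_seq => x /Gfix /(frob_fixedP pK)[c cp GE].
  rewrite (bigD1 (Ordinal cp)) //= GE eqxx big1 // => c' c'c.
  apply/eqP; rewrite eqb0; apply: contra c'c => /eqP /(natK_inj pK) E.
  by apply/eqP/ord_inj; rewrite /= E.
have -> : Ssum pK z F n = \sum_(c < p) z ^+ c * ((Z c)%:R - B%:R).
  under [RHS]eq_bigr do rewrite mulrBr.
  by rewrite sumrB -mulr_suml sumz0 mul0r subr0.
apply: le_trans (ler_norm_sum _ _ _) _.
apply: le_trans (_ : (\sum_(c < p) (B - Z c))%:R <= _).
  rewrite natr_sum; apply: ler_sum => c _.
  rewrite normrM normrX z1 expr1n mul1r distrC -natrB //.
  by rewrite normr_nat.
rewrite -natrX -natrM ler_nat.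
have : (\sum_(c < p) (B - Z c) + p ^ n = p * B)%N.
  rewrite -Zsum -big_split /=; under eq_bigr do rewrite subnK //.
  by rewrite sum_nat_const card_ord.
rewrite /B mulnDr mulnA -expnS -/r (_ : p ^ n = r * r)%N; last by rewrite -expnD.
move: (\sum_(c < p) _)%N => s E; rewrite -/r.
suff -> : s = (2 * d * p * r)%N by [].
apply/eqP; rewrite -(eqn_add2r (r * r)) E; apply/eqP.
by rewrite addnC; congr (_ + _)%N; rewrite -!mulnA mulnCA; congr (2 * _)%N; rewrite mulnCA.
Qed.

(** [L] is the reversed L-polynomial, monic because [Asum 0 = 1], so its roots [w] give [esgn w] the
    coefficients [Asum]. Newton's identities for [w] and [Asum_newton] are then the same recurrence
    up to sign. *)
Lemma Ssum_power_sum : exists w : seq C, size w = d.-1 /\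
  forall k, Ssum pK z F k.+1 = - psum w k.+1.
Proof.
have Ad k : (d <= k)%N -> Asum p z F k = 0.
  apply: (Asum_eq0 zp FF szF d0); apply/lregP; rewrite subr_eq0.
  apply/eqP => /(psi_eq1 pK zp) E.
  have /eqP : - (d%:R * F`_d) = 0.
    apply: E; rewrite -(pFrobenius_autE pK) rmorphN rmorphM rmorph_nat /= pFrobenius_autE.
    by rewrite frob_fixed_coef.
  rewrite oppr_eq0 mulf_eq0 -(dvdn_pcharf pK) gtnNdvd //=.
  have -> : F`_d = lead_coef F by rewrite lead_coefE szF.
  by rewrite lead_coef_eq0 -size_poly_eq0 szF.
pose L : {poly C} := 'X^(d.-1) + \poly_(j < d.-1) Asum p z F (d.-1 - j).
have szL : size L = d by rewrite size_polyDl size_polyXn ?ltnS ?size_poly // prednK.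
have Lm : L \is monic.
  by rewrite monicE lead_coefE szL coefD coefXn eqxx coef_poly ltnn addr0.
have LE j : (j <= d.-1)%N -> L`_(d.-1 - j) = Asum p z F j.
  move=> jd; rewrite coefD coefXn coef_poly; case: j jd => [|j] jd.
    by rewrite subn0 eqxx ltnn addr0 (Asum0 pK zp).
  rewrite (_ : (_ == _) = false); last by move: jd; clear; lia.
  rewrite ifT ?add0r; last by move: jd; clear; lia.
  by rewrite subKn.
have [w] := closed_field_poly_normal L; rewrite (monicP Lm) scale1r => wE.
have szw : size w = d.-1 by have := szL; rewrite wE size_prod_XsubC => <-.
have eA j : (esgn w)`_j = Asum p z F j.
  case: (leqP j d.-1) => jd; first by rewrite coef_esgn szw // -wE LE.
  rewrite Ad ?nth_default //; last by rewrite -(prednK d0).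
  by rewrite (leq_trans (size_esgn w)) // szw.
exists w; split=> // k; elim/ltn_ind: k => k IH.
have := newton_psum w k.+1; rewrite eA (Asum_newton zp FF) !big_ord_recr /= subnn.
rewrite eA (Asum0 pK zp) !mulr1 opprD => /eqP; rewrite -sumrN.
have -> : \sum_(i < k) - (psum w i.+1 * (esgn w)`_(k.+1 - i.+1)) =
  \sum_(i < k) Ssum pK z F i.+1 * Asum p z F (k.+1 - i.+1).
  by apply: eq_bigr => i _; rewrite IH // mulNr eA.
by move=> /eqP /addrI.
Qed.

Lemma Ssum_bound : `|Ssum pK z F 1| <= d.-1%:R * sqrtC p%:R.
Proof.
have [w [szw wP]] := Ssum_power_sum.
have wb t : t \in w -> `|t| <= sqrtC p%:R.
  (* Only sums of even index are bounded, so the growth argument is applied to the squares of the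
     [w]. *)
  move=> tw; have : `|t ^+ 2| <= p%:R.
    apply: (psum_growth archi (l := [seq u ^+ 2 | u <- w]) (B := (2 * d * p)%:R)).
    - by rewrite ltr0n.
    - move=> m; have -> : psum [seq u ^+ 2 | u <- w] m.+1 = psum w (m.+1 + m.+1).
        by rewrite /psum big_map; apply: eq_bigr => u _; rewrite -exprM mul2n addnn.
      by rewrite -normrN addSn -wP -addSn Ssum_even_bound.
    - exact: map_f.
  rewrite normrX => tp.
  by rewrite -(@ler_pXn2r _ 2) ?nnegrE ?sqrtC_ge0 ?ler0n // sqrtCK.
rewrite wP normrN /psum; under eq_bigr do rewrite expr1.
apply: le_trans (ler_norm_sum _ _ _) _; rewrite -szw -sum1_size natr_sum mulr_suml.
by rewrite !big_seq; apply: ler_sum => t tw; rewrite mul1r wb.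
Qed.

Lemma Ssum1 : Ssum pK z F 1 = \sum_(n < p) psi p z F.[n%:R].
Proof.
transitivity (\sum_(x <- [seq n%:R | n <- iota 0 p]) psi p z F.[x]).
  rewrite /Ssum; under eq_bigr do rewrite big_ord_recl big_ord0 addr0 expn0 expr1.
  apply: perm_big; apply: uniq_perm; first exact: Fq_uniq.
    rewrite map_inj_in_uniq ?iota_uniq // => m n; rewrite !mem_iota => /= mp np.
    exact: (natK_inj pK).
  move=> x; rewrite mem_Fq // expn1; apply/eqP/mapP => [/(frob_fixedP pK)[m mp ->]|[m _ ->]].
    by exists m; rewrite ?mem_iota.
  by rewrite -(pFrobenius_autE pK) pFrobenius_aut_nat.
by rewrite big_map -{1}[p]subn0 -/(index_iota 0 p) big_mkord.
Qed.

End Weil.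

Theorem weil_bound (C : numClosedFieldType) (archi : forall x : C, exists n : nat, `|x| < n%:R)
  (p : nat) (p_pr : prime p) (z : C) (zp : p.-primitive_root z) (a : nat -> nat) (d : nat) :
  (0 < d < p)%N -> ~~ (p %| a d)%N ->
  `|\sum_(n < p) z ^+ (\sum_(j < d.+1) a j * n ^ j)%N| <= d.-1%:R * sqrtC p%:R.
Proof.
move=> /andP[d0 dp] pad.
have [K [FtoK _]] := countable_algebraic_closure 'F_p.
have pK : p \in [pchar K] by rewrite (fmorph_pchar FtoK) pchar_Fp.
pose F : {poly K} := \poly_(j < d.+1) (a j)%:R.
have szF : size F = d.+1 by rewrite size_poly_eq // -(dvdn_pcharf pK).
have FF : frob_fixed pK F.
  apply/frob_fixedI => i; rewrite -(pFrobenius_autE pK) coef_poly.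
  by case: ifP => _; rewrite ?pFrobenius_aut_nat ?pFrobenius_aut0.
have := Ssum_bound zp archi FF szF d0 dp; rewrite Ssum1.
rewrite (eq_bigr (fun n : 'I_p => z ^+ (\sum_(j < d.+1) a j * n ^ j)%N)) // => n _.
rewrite -(psi_nat pK zp); congr (psi _ _); rewrite natr_sum /F horner_poly.
by apply: eq_bigr => j _; rewrite natrM natrX.
Qed.

(** * Transfer to cosine sums over the real numbers *)

Local Notation R := Rdefinitions.R.
Local Delimit Scope R_scope with coqR.

Lemma rsum_iota (f : nat -> R) m n : rsum f (List.seq m n) = \sum_(m <= i < m + n) f i.
Proof.
elim: n m => [|n IH] m; first by rewrite addn0 big_geq.
rewrite /rsum /= -/(rsum f (List.seq m.+1 n)) IH RplusE big_ltn ?addSnnS //.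
by rewrite -[X in (X < _)%N]addn0 ltn_add2l.
Qed.

Lemma nat_polyE a d n : nat_poly a d n = (\sum_(j < d.+1) a j * n ^ j)%N.
Proof.
rewrite -(big_mkord predT (fun j => a j * n ^ j)%N) /nat_poly.
suff H m k : fold_right Nat.add 0%N (List.map (fun j => Nat.mul (a j) (Nat.pow n j)) (List.seq m k))
   = (\sum_(m <= j < m + k) a j * n ^ j)%N by rewrite H.
elim: k m => [|k IH] m; first by rewrite addn0 big_geq.
rewrite /= IH [RHS]big_ltn ?addSnnS; last by rewrite -[X in (X < _)%N]addn0 ltn_add2l.
congr (_ + _)%N; rewrite multE; congr (_ * _)%N.
by elim: (m) => // m' IHm; rewrite expnS /= multE IHm.
Qed.

Definition cis (t : R) : R[i] := Complex (cos t) (sin t).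

Lemma cisD s t : cis (s + t) = cis s * cis t.
Proof. by rewrite /cis cosD sinD; apply/eqP; rewrite eq_complex /= [sin s * _ + _]addrC !eqxx. Qed.

Lemma cisX t n : cis t ^+ n = cis (t *+ n).
Proof.
elim: n => [|n IH]; first by rewrite expr0 mulr0n /cis cos_0 sin_0.
by rewrite exprS IH mulrS cisD.
Qed.

Lemma Re_sum (I : Type) (r : seq I) (P : pred I) (f : I -> R[i]) :
  complex.Re (\sum_(i <- r | P i) f i) = \sum_(i <- r | P i) complex.Re (f i).
Proof. by apply: (big_morph _ _ erefl) => -[a b] [c d]. Qed.

Lemma complex_archi (x : R[i]) : exists n : nat, `|x| < n%:R.
Proof.
rewrite normc_def; set r := Num.sqrt _.
exists (Num.bound r); rewrite -(rmorph_nat (real_complex R)) ltcR.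
by apply: archi_boundP; exact: sqrtr_ge0.
Qed.

Lemma prime_Z_nat N : Znumtheory.prime (Z.of_nat N) -> prime N.
Proof.
move=> [N1 cop]; apply/primeP; split; first by lia.
move=> k /dvdnP[q qE].
have [k1|k1] := eqVneq k 1%N => //=; apply/eqP.
have kN : (k <= N)%N.
  by rewrite qE leq_pmull //; move: qE N1; case: (q) => // ->; lia.
apply/eqP; case: ltngtP kN => // kN _; exfalso.
have k0 : (0 < k)%N by move: qE N1; case: (k) => // ->; lia.
have k1' : (1 < k)%N by move: k0 k1; clear; lia.
have [_ _ H] : rel_prime (Z.of_nat k) (Z.of_nat N) by apply: cop; lia.
have dkN : Z.divide (Z.of_nat k) (Z.of_nat N) by exists (Z.of_nat q); lia.
have := Z.divide_pos_le _ _ Z.lt_0_1 (H _ (Z.divide_refl _) dkN); lia.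
Qed.

Lemma cis_primitive N : prime N -> N.-primitive_root (cis (2 * PI / INR N)%coqR).
Proof.
move=> Npr; have N0 := prime_gt0 Npr; have N1 := prime_gt1 Npr.
have E1 : cis (2 * PI / INR N)%coqR ^+ N = 1.
  rewrite cisX -mulr_natr -INRE -RmultE /Rdiv Rmult_assoc Rinv_l ?Rmult_1_r.
    by rewrite /cis cos_2PI sin_2PI.
  by apply: not_0_INR => N00; rewrite N00 in N0.
have [m mN] := prim_order_exists N0 E1.
(* The order divides the prime [N]; order one would give [cos (2 * PI / N) = 1], although cosine
   decreases strictly on [[0, PI]]. *)
move: Npr => /primeP[_ dv] /dv /orP[] /eqP E; subst m => //.
have := prim_expr_order mN; rewrite expr1 /cis => -[c1 _].
have Nge : (2 <= INR N)%coqR by apply: (le_INR 2); apply/ssrnat.leP.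
have PI0 := PI_RGT_0.
have tpos : (0 < 2 * PI / INR N)%coqR by apply: Rdiv_lt_0_compat; Lra.lra.
have tle : (2 * PI / INR N <= PI)%coqR.
  apply: (Rmult_le_reg_r (INR N)); first by Lra.lra.
  rewrite /Rdiv Rmult_assoc Rinv_l; last by Lra.lra.
  by Lra.nra.
have := cos_decreasing_1 _ _ (Rle_refl 0) (Rlt_le _ _ PI0) (Rlt_le _ _ tpos) tle tpos.
by rewrite cos_0 c1 => /Rlt_irrefl.
Qed.

Lemma weil_cos_sum (N : nat) (a : nat -> nat) (d : nat) :
  Znumtheory.prime (Z.of_nat N) -> Nat.lt 0 d -> Nat.lt d N -> ~ Nat.divide N (a d) ->
  Rle (Rabs (unit_cos_sum N (nat_poly a d))) (Rmult (Rminus (INR d) R1) (sqrt (INR N))).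
Proof.
move=> /prime_Z_nat Npr /ssrnat.ltP d0 /ssrnat.ltP dN ndv.
have N0 := prime_gt0 Npr.
have pad : ~~ (N %| a d)%N.
  by apply/negP => /dvdnP[q qE]; apply: ndv; exists q; rewrite qE.
have := weil_bound complex_archi Npr (cis_primitive Npr) (a := a) (d := d); rewrite d0 dN => /(_ isT pad).
set S := \sum_(n < N) _ => H.
have SE : unit_cos_sum N (nat_poly a d) = complex.Re S.
  rewrite /unit_cos_sum rsum_iota add0n big_mkord /S Re_sum; apply: eq_bigr => n _.
  rewrite cisX /= nat_polyE; congr cos.
  by rewrite -mulr_natr -INRE -[RHS]/(_ * _)%coqR /Rdiv [RHS]Rmult_assoc [LHS]Rmult_assoc
       [in RHS](Rmult_comm (/ INR N)).
have sN : sqrtC (N%:R : R[i]) = (Num.sqrt N%:R)%:C%C.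
  rewrite -[N%:R in LHS](rmorph_nat (real_complex R)) -{1}[N%:R](@sqr_sqrtr R) ?ler0n //.
  by rewrite rmorphXn /= sqrCK // lecR sqrtr_ge0.
have d1 : INR d - 1 = d.-1%:R :> R by rewrite INRE -subn1 natrB.
apply/RleP; rewrite RabsE RmultE RsqrtE RminusE (INRE N) SE.
move: H; rewrite sN -[d.-1%:R](rmorph_nat (real_complex R)) -rmorphM /= normc_def lecR => H.
rewrite -[R1]/(1 : R) d1.
by apply: le_trans H; rewrite -sqrtr_sqr; apply: ler_wsqrtr; rewrite lerDl sqr_ge0.
Qed.

End WeilBound.

(** * Finite sums over lists and tuples *)

Lemma rsum_cons {A} (f : A -> R) a l : rsum f (a :: l) = f a + rsum f l.
Proof. reflexivity. Qed.

Lemma rsum_app {A} (f : A -> R) l1 l2 : rsum f (l1 ++ l2) = rsum f l1 + rsum f l2.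
Proof.
induction l1 as [|a l1 IH]; simpl; [unfold rsum at 2; simpl; ring|].
rewrite !rsum_cons, IH; ring.
Qed.

Lemma rsum_ext {A} (f g : A -> R) l : (forall a, In a l -> f a = g a) -> rsum f l = rsum g l.
Proof.
induction l as [|a l IH]; intros H; [reflexivity|].
rewrite !rsum_cons, IH, (H a); [reflexivity|now left|intros b Hb; apply H; now right].
Qed.

Lemma rsum_le {A} (f g : A -> R) l : (forall a, In a l -> f a <= g a) -> rsum f l <= rsum g l.
Proof.
induction l as [|a l IH]; intros H; [unfold rsum; simpl; lra|].
rewrite !rsum_cons; apply Rplus_le_compat; [apply H; now left|].
apply IH; intros b Hb; apply H; now right.
Qed.

Lemma rsum_plus {A} (f g : A -> R) l : rsum (fun a => f a + g a) l = rsum f l + rsum g l.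
Proof.
induction l as [|a l IH]; [unfold rsum; simpl; ring|].
rewrite !rsum_cons, IH; ring.
Qed.

Lemma rsum_scal {A} (c : R) (f : A -> R) l : rsum (fun a => c * f a) l = c * rsum f l.
Proof.
induction l as [|a l IH]; [unfold rsum; simpl; ring|].
rewrite !rsum_cons, IH; ring.
Qed.

Lemma rsum_minus {A} (f g : A -> R) l : rsum (fun a => f a - g a) l = rsum f l - rsum g l.
Proof.
induction l as [|a l IH]; [unfold rsum; simpl; ring|].
rewrite !rsum_cons, IH; ring.
Qed.

Lemma rsum_const {A} (c : R) (l : list A) : rsum (fun _ => c) l = INR (length l) * c.
Proof.
induction l as [|a l IH]; [unfold rsum; simpl; ring|].
rewrite rsum_cons, IH; change (length (a :: l)) with (S (length l)); rewrite S_INR; ring.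
Qed.

Lemma rsum_abs {A} (f : A -> R) l : Rabs (rsum f l) <= rsum (fun a => Rabs (f a)) l.
Proof.
induction l as [|a l IH]; [unfold rsum; simpl; rewrite Rabs_R0; lra|].
rewrite !rsum_cons; eapply Rle_trans; [apply Rabs_triang|lra].
Qed.

Lemma rsum_nonneg {A} (f : A -> R) l : (forall a, In a l -> 0 <= f a) -> 0 <= rsum f l.
Proof.
intros H; replace 0 with (rsum (fun _ => 0) l); [now apply rsum_le|].
rewrite rsum_const; ring.
Qed.

Lemma rsum_map {A B} (f : B -> R) (h : A -> B) l : rsum f (map h l) = rsum (fun a => f (h a)) l.
Proof. unfold rsum; now rewrite map_map. Qed.

Lemma rsum_flat_map {A B} (f : B -> R) (h : A -> list B) l :
  rsum f (flat_map h l) = rsum (fun a => rsum f (h a)) l.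
Proof.
induction l as [|a l IH]; [reflexivity|].
simpl; rewrite rsum_app, IH; reflexivity.
Qed.

Lemma rsum_swap {A B} (f : A -> B -> R) l1 l2 :
  rsum (fun a => rsum (f a) l2) l1 = rsum (fun b => rsum (fun a => f a b) l1) l2.
Proof.
induction l1 as [|a l1 IH].
- unfold rsum at 1; simpl; symmetry; unfold rsum at 2; simpl.
  rewrite rsum_const; ring.
- rewrite rsum_cons, IH, <- rsum_plus; reflexivity.
Qed.

Lemma rsum_perm {A} (f : A -> R) l1 l2 : Permutation l1 l2 -> rsum f l1 = rsum f l2.
Proof.
induction 1; rewrite ?rsum_cons; try congruence; try lra.
Qed.

Lemma rsum_seq_S (f : nat -> R) n : rsum f (seq 0 (S n)) = rsum f (seq 0 n) + f n.
Proof. rewrite seq_S, rsum_app, rsum_cons; simpl; unfold rsum at 2; simpl; ring. Qed.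

Lemma rsum_seq_0 (f : nat -> R) n : rsum f (seq 0 (S n)) = f 0%nat + rsum (fun i => f (S i)) (seq 0 n).
Proof. simpl; rewrite rsum_cons, <- seq_shift, rsum_map; reflexivity. Qed.

Lemma rsum_seq_rev (f : nat -> R) n :
  rsum (fun i => f (n - i)%nat) (seq 0 n) = rsum (fun i => f (S i)) (seq 0 n).
Proof.
induction n as [|n IH]; [reflexivity|].
rewrite rsum_seq_0, rsum_seq_S, <- IH, Nat.sub_0_r.
rewrite Rplus_comm; f_equal.
Qed.

Lemma rsum_tuples_S n m (f : list nat -> R) :
  rsum f (tuples (S n) m) = rsum (fun i => rsum (fun t => f (i :: t)) (tuples n m)) (seq 0 m).
Proof.
simpl; rewrite rsum_flat_map; apply rsum_ext; intros i _; now rewrite rsum_map.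
Qed.

Lemma tuples_In n m t : In t (tuples n m) -> length t = n /\ Forall (fun i => (i < m)%nat) t.
Proof.
revert t; induction n as [|n IH]; intros t; simpl.
- intros [<-|[]]; auto.
- rewrite in_flat_map; intros [i [Hi Ht]]; apply in_map_iff in Ht; destruct Ht as [t' [<- Ht']].
  apply in_seq in Hi; destruct (IH _ Ht') as [Hl Hf]; simpl; split; [congruence|].
  constructor; [lia|assumption].
Qed.

Lemma rsum_tuples_const n m (c : R) : rsum (fun _ => c) (tuples n m) = INR m ^ n * c.
Proof.
induction n as [|n IH]; [unfold rsum; simpl; ring|].
rewrite rsum_tuples_S, (rsum_ext _ (fun _ => INR m ^ n * c)); [|intros; apply IH].
rewrite rsum_const, length_seq; simpl; ring.
Qed.

Lemma pow_INR_pos m n : (1 <= m)%nat -> 0 < INR m ^ n.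
Proof. intros; apply pow_lt, lt_0_INR; lia. Qed.

(** * Hoelder bound in terms of coordinates *)

Lemma pw_nonneg a q : 0 <= pw a q.
Proof. unfold pw; destruct Req_EM_T; [lra|apply Rlt_le, exp_pos]. Qed.

Lemma pw_le a q d : 1 <= q -> 0 <= a <= d -> 0 < d -> pw a q <= Rpower d q.
Proof.
intros Hq Ha Hd; unfold pw; destruct Req_EM_T; [apply Rlt_le, exp_pos|].
apply Rle_Rpower_l; lra.
Qed.

Lemma s_pow_pos s alpha p : 0 < s_pow s alpha p.
Proof. destruct p; simpl; [apply exp_pos|lra]. Qed.

(** Entries of size at most [d] give the norm bound [s^(1/p) * d]. A nonzero entry is required
    because [Rpower] is monotone only on positive bases and does not vanish at [0]. *)
Lemma lpnorm_le p alpha h d : 0 < alpha -> valid_p p -> 0 < d ->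
  Forall (fun t => Rabs t <= d) h -> Exists (fun t => t <> 0) h ->
  Rpower (lpnorm p h) alpha <= s_pow (length h) alpha p * Rpower d alpha.
Proof.
intros Ha Hp Hd Hf He.
assert (Hl : (1 <= length h)%nat) by (destruct h; [inversion He|simpl; lia]).
destruct p as [q|]; simpl in *.
- assert (S1 : rsum (fun t => pw (Rabs t) q) h <= INR (length h) * Rpower d q).
  { rewrite <- rsum_const; apply rsum_le; intros t Ht.
    apply pw_le; try lra; split; [apply Rabs_pos|].
    rewrite Forall_forall in Hf; now apply Hf. }
  assert (S0 : 0 < rsum (fun t => pw (Rabs t) q) h).
  { clear S1 Hf Hl; induction He as [t h Ht|t h He IH]; rewrite rsum_cons.
    - apply Rplus_lt_le_0_compat; [|apply rsum_nonneg; intros; apply pw_nonneg].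
      unfold pw; destruct Req_EM_T as [E|_]; [|apply exp_pos].
      exfalso; revert E; now apply Rabs_no_R0.
    - apply Rplus_le_lt_0_compat; [apply pw_nonneg|assumption]. }
  rewrite Rpower_mult.
  eapply Rle_trans; [apply Rle_Rpower_l; [|split; [exact S0|exact S1]]|].
  + apply Rmult_le_pos; [left; apply Rinv_0_lt_compat; lra|lra].
  + rewrite <- Rpower_mult_distr; [|apply lt_0_INR; lia|apply exp_pos].
    rewrite Rpower_mult.
    replace (q * (/ q * alpha)) with alpha by (field; lra).
    replace (/ q * alpha) with (alpha / q) by (unfold Rdiv; ring); lra.
- rewrite Rmult_1_l; apply Rle_Rpower_l; [lra|].
  assert (P0 : forall l, 0 <= fold_right Rmax 0 (map Rabs l)).
  { induction l as [|t l IH]; simpl; [lra|]; eapply Rle_trans; [apply IH|apply Rmax_r]. }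
  split.
  + clear Hf Hl; induction He as [t h Ht|t h He IH]; simpl.
    * eapply Rlt_le_trans; [apply (Rabs_pos_lt t Ht)|apply Rmax_l].
    * eapply Rlt_le_trans; [apply IH|apply Rmax_r].
  + clear He Hl; induction Hf as [|t h Ht Hf IH]; simpl; [lra|].
    apply Rmax_lub; assumption.
Qed.

Definition close (d : R) (x y : list R) : Prop := Forall2 (fun a b => Rabs (a - b) <= d) x y.

Lemma vsub_neq x y : length x = length y -> x <> y -> Exists (fun t => t <> 0) (vsub y x).
Proof.
revert y; induction x as [|a x IH]; intros [|b y] Hl Hn; simpl in *; try discriminate;
  [now destruct Hn|].
destruct (Req_EM_T (b - a) 0) as [E|E]; [|left; exact E].
right; apply IH; [congruence|]; intros ->; apply Hn; f_equal; lra.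
Qed.

Lemma holder_close s alpha p g L d x y : 0 < alpha -> valid_p p -> 0 < d -> 0 <= L ->
  holder_bound s alpha p g L -> in_cube s x -> in_cube s y -> close d y x ->
  Rabs (g y - g x) <= L * s_pow s alpha p * Rpower d alpha.
Proof.
intros Ha Hp Hd HL Hh Hx Hy Hc.
assert (P : 0 <= L * s_pow s alpha p * Rpower d alpha).
{ apply Rmult_le_pos; [apply Rmult_le_pos; [exact HL|apply Rlt_le, s_pow_pos]|apply Rlt_le, exp_pos]. }
destruct (list_eq_dec Req_EM_T x y) as [->|Hn].
- replace (g y - g y) with 0 by ring; rewrite Rabs_R0; exact P.
- eapply Rle_trans; [apply Hh; assumption|].
  rewrite Rmult_assoc; apply Rmult_le_compat_l; [exact HL|].
  assert (Hlen : length (vsub y x) = s).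
  { unfold vsub; rewrite length_map, length_combine; destruct Hx as [-> _], Hy as [-> _]; lia. }
  rewrite <- Hlen; apply lpnorm_le; try assumption.
  + clear -Hc; induction Hc; constructor; assumption.
  + apply vsub_neq; [destruct Hx, Hy; congruence|exact Hn].
Qed.

(** * Fejer kernel *)

(** The squared modulus of the sum of [exp(i j t)] over [j < M], that is, [M] times the usual Fejer
    kernel; [csum] and [ssum] are the real and imaginary parts of that sum. *)
Definition fejer (M : nat) (t : R) : R :=
  rsum (fun k => (if Nat.eqb k 0 then 1 else 2) * (INR M - INR k) * cos (INR k * t)) (seq 0 M).

Lemma fejer_S M t :
  fejer (S M) t = fejer M t + 1 + 2 * rsum (fun j => cos (INR (S j) * t)) (seq 0 M).
Proof.
pose (b := fun k => (if Nat.eqb k 0 then 1 else 2) * cos (INR k * t)).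
transitivity (fejer M t + rsum b (seq 0 (S M))).
- unfold fejer; rewrite !rsum_seq_S, <- Rplus_assoc, <- rsum_plus; f_equal.
  + apply rsum_ext; intros k _; unfold b; rewrite S_INR; ring.
  + unfold b; rewrite S_INR; ring.
- rewrite rsum_seq_0; unfold b at 1; simpl Nat.eqb; cbv iota; rewrite Rmult_0_l, cos_0.
  rewrite (rsum_ext _ (fun j => 2 * cos (INR (S j) * t))); [rewrite rsum_scal; ring|].
  intros j _; reflexivity.
Qed.

Definition csum M t := rsum (fun j => cos (INR j * t)) (seq 0 M).
Definition ssum M t := rsum (fun j => sin (INR j * t)) (seq 0 M).

Lemma fejer_squares M t : fejer M t = csum M t ^ 2 + ssum M t ^ 2.
Proof.
induction M as [|M IH]; [unfold fejer, csum, ssum, rsum; simpl; ring|].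
rewrite fejer_S, IH; unfold csum, ssum; rewrite !rsum_seq_S.
fold (csum M t); fold (ssum M t).
(* Reversal writes the new cosines as [cos ((M - j) t)], the cross terms between [exp(i M t)] and
   the earlier exponentials. *)
rewrite <- (rsum_seq_rev (fun j => cos (INR j * t))).
rewrite (rsum_ext _ (fun j => cos (INR M * t) * cos (INR j * t) + sin (INR M * t) * sin (INR j * t))).
- rewrite rsum_plus, !rsum_scal; fold (csum M t); fold (ssum M t).
  generalize (sin2_cos2 (INR M * t)); unfold Rsqr; nra.
- intros j Hj; apply in_seq in Hj; rewrite minus_INR by lia.
  replace ((INR M - INR j) * t) with (INR M * t - INR j * t) by ring.
  apply cos_minus.
Qed.

Lemma csum_sin M t : 2 * sin (t / 2) * csum M t = sin (INR M * t - t / 2) + sin (t / 2).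
Proof.
induction M as [|M IH].
- unfold csum, rsum; simpl; rewrite Rmult_0_l, Rminus_0_l, sin_neg; ring.
- unfold csum; rewrite rsum_seq_S; fold (csum M t); rewrite Rmult_plus_distr_l, IH.
  replace (INR (S M) * t - t / 2) with (INR M * t + t / 2) by (rewrite S_INR; field).
  rewrite sin_plus, sin_minus; ring.
Qed.

Lemma ssum_sin M t : 2 * sin (t / 2) * ssum M t = cos (t / 2) - cos (INR M * t - t / 2).
Proof.
induction M as [|M IH].
- unfold ssum, rsum; simpl; rewrite Rmult_0_l, Rminus_0_l, cos_neg; ring.
- unfold ssum; rewrite rsum_seq_S; fold (ssum M t); rewrite Rmult_plus_distr_l, IH.
  replace (INR (S M) * t - t / 2) with (INR M * t + t / 2) by (rewrite S_INR; field).
  rewrite cos_plus, cos_minus; ring.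
Qed.

Lemma fejer_nonneg M t : 0 <= fejer M t.
Proof. rewrite fejer_squares; nra. Qed.

(** Multiplied by [4 sin^2 (t/2)], the squared geometric sum becomes [|1 - exp(i M t)|^2 <= 4]; in
    the proof [A + B = M t]. *)
Lemma fejer_tail M t : fejer M t * sin (t / 2) ^ 2 <= 1.
Proof.
rewrite fejer_squares.
assert (H := csum_sin M t); assert (H' := ssum_sin M t).
set (A := INR M * t - t / 2) in *; set (B := t / 2) in *.
assert (E : 4 * ((csum M t ^ 2 + ssum M t ^ 2) * sin B ^ 2) = 2 - 2 * cos (A + B)).
{ transitivity ((2 * sin B * csum M t) ^ 2 + (2 * sin B * ssum M t) ^ 2); [ring|].
  rewrite H, H', cos_plus.
  generalize (sin2_cos2 A) (sin2_cos2 B); unfold Rsqr; intros; nra. }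
generalize (COS_bound (A + B)); lra.
Qed.

Definition fw (M k : nat) : R := 1 - INR k / INR M.

Lemma fw_bounds M k : (k < M)%nat -> 0 <= fw M k <= 1.
Proof.
intros H; assert (0 < INR M) by (apply lt_0_INR; lia).
assert (0 <= INR k <= INR M) by (split; [apply pos_INR|apply le_INR; lia]).
unfold fw; split.
- apply Rmult_le_reg_r with (INR M); [assumption|].
  unfold Rdiv; rewrite Rmult_minus_distr_r, Rmult_assoc, Rinv_l; lra.
- assert (0 <= INR k / INR M) by (apply Rmult_le_pos; [lra|left; now apply Rinv_0_lt_compat]); lra.
Qed.

Definition fkernel (M : nat) (x t : R) : R :=
  rsum (fun k => fw M k * sigma1 k x * sigma1 k t) (seq 0 M).

(** The cosine system is the even half of the Fourier system of period [2], so its kernel is a Fejer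
    kernel plus a reflected copy and inherits positivity and decay. *)
Lemma fkernel_fejer M x t : (1 <= M)%nat ->
  2 * INR M * fkernel M x t = fejer M (PI * (x - t)) + fejer M (PI * (x + t)).
Proof.
intros HM; assert (0 < INR M) by (apply lt_0_INR; lia).
unfold fkernel, fejer; rewrite <- rsum_scal, <- rsum_plus; apply rsum_ext; intros k Hk.
assert (E : fw M k * INR M = INR M - INR k) by (unfold fw; field; lra).
replace (2 * INR M * (fw M k * sigma1 k x * sigma1 k t))
  with (2 * (fw M k * INR M) * (sigma1 k x * sigma1 k t)) by ring.
rewrite E; destruct k as [|k]; simpl Nat.eqb; cbv iota.
- simpl; rewrite !Rmult_0_l, cos_0; ring.
- unfold sigma1.
  replace (sqrt 2 * cos (PI * INR (S k) * x) * (sqrt 2 * cos (PI * INR (S k) * t))) with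
   (2 * cos (PI * INR (S k) * x) * cos (PI * INR (S k) * t)).
  2: { replace 2 with (sqrt 2 * sqrt 2) at 1 by (apply sqrt_def; lra); ring. }
  replace (INR (S k) * (PI * (x - t))) with (PI * INR (S k) * x - PI * INR (S k) * t) by ring.
  replace (INR (S k) * (PI * (x + t))) with (PI * INR (S k) * x + PI * INR (S k) * t) by ring.
  rewrite cos_minus, cos_plus; ring.
Qed.

Lemma fkernel_nonneg M x t : (1 <= M)%nat -> 0 <= fkernel M x t.
Proof.
intros HM; assert (0 < INR M) by (apply lt_0_INR; lia).
assert (H0 := fkernel_fejer M x t HM).
assert (H1 := fejer_nonneg M (PI * (x - t))); assert (H2 := fejer_nonneg M (PI * (x + t))).
apply Rmult_le_reg_l with (2 * INR M); lra.
Qed.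

Lemma fkernel_tail M x t d : (1 <= M)%nat -> 0 <= x <= 1 -> 0 <= t <= 1 -> 0 < d ->
  d < Rabs (x - t) -> fkernel M x t <= / (INR M * sin (PI * d / 2) ^ 2).
Proof.
intros HM Hx Ht Hd Hxt; assert (HM0 : 0 < INR M) by (apply lt_0_INR; lia).
assert (P := PI_RGT_0).
assert (d1 : d < 1) by (unfold Rabs in Hxt; destruct Rcase_abs; lra).
set (sd := sin (PI * d / 2)).
assert (Hsd : 0 < sd) by (apply sin_gt_0; nra).
assert (key : forall u, d <= u <= 2 - d -> sd <= sin (PI * u / 2)).
{ intros u Hu; unfold sd.
  destruct (Rle_dec u 1) as [u1|u1].
  - apply sin_incr_1; nra.
  - rewrite <- (sin_PI_x (PI * u / 2)); apply sin_incr_1; nra. }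
assert (bound : forall u, sd <= sin (PI * u / 2) -> fejer M (PI * u) * sd ^ 2 <= 1).
{ intros u Hu; eapply Rle_trans; [|apply (fejer_tail M (PI * u))].
  apply Rmult_le_compat_l; [apply fejer_nonneg|].
  apply pow_incr; lra. }
assert (even : fejer M (PI * (x - t)) = fejer M (PI * Rabs (x - t))).
{ unfold Rabs; destruct Rcase_abs; [|reflexivity].
  unfold fejer; apply rsum_ext; intros k _; f_equal.
  rewrite <- cos_neg; f_equal; ring. }
assert (H0 := fkernel_fejer M x t HM).
assert (B1 : fejer M (PI * (x - t)) * sd ^ 2 <= 1).
{ rewrite even; apply bound, key; split; [lra|]; unfold Rabs in *; destruct Rcase_abs; lra. }
(* The reflected term is no worse: both [x + t] and [2 - (x + t)] are at least [|x - t|] on the unit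
   square. *)
assert (B2 : fejer M (PI * (x + t)) * sd ^ 2 <= 1).
{ apply bound, key; unfold Rabs in Hxt; destruct Rcase_abs; lra. }
assert (sd2 : 0 < sd ^ 2) by (apply pow_lt; assumption).
apply Rmult_le_reg_r with (INR M * sd ^ 2); [now apply Rmult_lt_0_compat|].
rewrite Rinv_l; [nra|]; apply Rgt_not_eq; now apply Rmult_lt_0_compat.
Qed.

Definition midpt (m i : nat) : R := (2 * INR i + 1) / (2 * INR m).

Lemma midpt_cell m i : (1 <= m)%nat -> INR i / INR m <= midpt m i <= INR (S i) / INR m.
Proof.
intros Hm; assert (0 < INR m) by (apply lt_0_INR; lia).
assert (0 < / INR m) by now apply Rinv_0_lt_compat.
replace (midpt m i) with ((INR i + 1 / 2) / INR m) by (unfold midpt; field; lra).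
rewrite S_INR; unfold Rdiv; split; apply Rmult_le_compat_r; lra.
Qed.

(** Discrete orthogonality, by telescoping after multiplication with [2 * sin a]. It makes midpoint
    sums exact on the kernel, so no integral of the kernel is needed. *)
Lemma midpt_sigma1 m k : (0 < k < m)%nat -> rsum (fun i => sigma1 k (midpt m i)) (seq 0 m) = 0.
Proof.
intros Hk; assert (Hm : 0 < INR m) by (apply lt_0_INR; lia).
assert (P := PI_RGT_0).
set (a := PI * INR k / (2 * INR m)).
assert (S1 : forall n, 2 * sin a * rsum (fun i => cos (a * (2 * INR i + 1))) (seq 0 n) = sin (2 * INR n * a)).
{ induction n as [|n IH].
  - unfold rsum; simpl; rewrite !Rmult_0_r, Rmult_0_l, sin_0; ring.
  - rewrite rsum_seq_S, Rmult_plus_distr_l, IH, S_INR.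
    replace (2 * (INR n + 1) * a) with (a * (2 * INR n + 1) + a) by ring.
    replace (2 * INR n * a) with (a * (2 * INR n + 1) - a) by ring.
    rewrite sin_plus, sin_minus; ring. }
assert (sa : 0 < sin a).
{ assert (0 < INR k < INR m) by (split; [apply lt_0_INR|apply lt_INR]; lia).
  apply sin_gt_0; unfold a.
  - apply Rmult_lt_0_compat; [nra|apply Rinv_0_lt_compat; lra].
  - apply Rmult_lt_reg_r with (2 * INR m); [lra|].
    unfold Rdiv; rewrite Rmult_assoc, Rinv_l; nra. }
rewrite (rsum_ext _ (fun i => sqrt 2 * cos (a * (2 * INR i + 1)))).
- rewrite rsum_scal.
  replace (rsum (fun i => cos (a * (2 * INR i + 1))) (seq 0 m)) with 0; [ring|].
  symmetry; apply Rmult_eq_reg_l with (2 * sin a); [|lra].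
  rewrite S1, Rmult_0_r.
  replace (2 * INR m * a) with (0 + INR k * PI) by (unfold a; field; lra).
  apply sin_eq_0_1; exists (Z.of_nat k); rewrite <- INR_IZR_INZ; ring.
- intros i _; destruct k as [|k]; [lia|]; unfold sigma1; f_equal; f_equal.
  unfold a, midpt; field; lra.
Qed.

Lemma fkernel_mean M m x : (1 <= M)%nat -> (M <= m)%nat ->
  rsum (fun i => fkernel M x (midpt m i)) (seq 0 m) = INR m.
Proof.
intros HM Hm; unfold fkernel; rewrite rsum_swap.
rewrite (rsum_ext _ (fun k => fw M k * sigma1 k x * rsum (fun i => sigma1 k (midpt m i)) (seq 0 m))).
2: { intros k _; now rewrite rsum_scal. }
destruct M as [|M]; [lia|].
rewrite rsum_seq_0.
replace (rsum (fun i => sigma1 0 (midpt m i)) (seq 0 m)) with (INR m).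
2: { transitivity (rsum (fun _ : nat => 1) (seq 0 m)); [|reflexivity].
  rewrite rsum_const, length_seq; ring. }
match goal with |- _ + ?T = _ => replace T with 0 end.
- unfold fw; simpl sigma1; simpl (INR 0).
  field; rewrite S_INR; generalize (pos_INR M); lra.
- symmetry; transitivity (rsum (fun _ : nat => 0) (seq 0 M)).
  + apply rsum_ext; intros k Hk; apply in_seq in Hk; rewrite midpt_sigma1 by lia; ring.
  + rewrite rsum_const; ring.
Qed.

(** * Uniform approximation by Fejer means *)

Lemma in_cube_cons s a x : in_cube (S s) (a :: x) <-> 0 <= a <= 1 /\ in_cube s x.
Proof.
unfold in_cube; simpl; split.
- intros [Hl Hf]; inversion Hf; subst; repeat split; try tauto; congruence.
- intros [Ha [Hl Hf]]; split; [congruence|now constructor].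
Qed.

Definition fkernels (M : nat) (x t : list R) : R :=
  fold_right Rmult 1 (map (fun xt => fkernel M (fst xt) (snd xt)) (combine x t)).
Definition fws (M : nat) (k : list nat) : R := fold_right Rmult 1 (map (fw M) k).
(** The far coordinates are counted, not merely detected: the count is additive, so the tail can be
    estimated coordinate by coordinate. *)
Definition far (d : R) (x t : list R) : R :=
  rsum (fun xt => if Rle_dec (Rabs (fst xt - snd xt)) d then 0 else 1) (combine x t).

Lemma fkernels_expand s M x t : length x = s -> length t = s ->
  rsum (fun k => fws M k * sigma k x * sigma k t) (tuples s M) = fkernels M x t.
Proof.
revert x t; induction s as [|s IH]; intros [|a x] [|b t] Hx Ht; try discriminate.
- unfold rsum, fws, sigma, fkernels; simpl; ring.
- rewrite rsum_tuples_S; simpl in Hx, Ht.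
  rewrite (rsum_ext _ (fun k => fkernels M x t * (fw M k * sigma1 k a * sigma1 k b))).
  + rewrite rsum_scal; unfold fkernels; simpl; fold (fkernels M x t); unfold fkernel; ring.
  + intros k _; rewrite <- (IH x t) by congruence.
    rewrite Rmult_comm, <- rsum_scal; apply rsum_ext; intros ks _.
    unfold fws, sigma; simpl; ring.
Qed.

Lemma fkernels_nonneg M x t : (1 <= M)%nat -> 0 <= fkernels M x t.
Proof.
intros HM; revert t; induction x as [|a x IH]; intros [|b t];
  unfold fkernels; simpl; try lra.
apply Rmult_le_pos; [now apply fkernel_nonneg|apply IH].
Qed.

Lemma fkernels_mean s M m x : (1 <= M)%nat -> (M <= m)%nat -> length x = s ->
  rsum (fun i => fkernels M x (map (midpt m) i)) (tuples s m) = INR m ^ s.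
Proof.
intros HM Hm; revert x; induction s as [|s IH]; intros [|a x] Hx; try discriminate.
- unfold rsum, fkernels; simpl; ring.
- rewrite rsum_tuples_S.
  rewrite (rsum_ext _ (fun i => INR m ^ s * fkernel M a (midpt m i))).
  + rewrite rsum_scal, fkernel_mean by assumption; simpl; ring.
  + intros i _; rewrite <- (IH x) by (simpl in Hx; congruence).
    rewrite Rmult_comm, <- rsum_scal; apply rsum_ext; intros is _; reflexivity.
Qed.

Lemma midpt_unit m i : (i < m)%nat -> 0 <= midpt m i <= 1.
Proof.
intros Hi; assert (0 < INR m) by (apply lt_0_INR; lia).
destruct (midpt_cell m i) as [H1 H2]; [lia|].
assert (0 < / INR m) by now apply Rinv_0_lt_compat.
assert (INR (S i) <= INR m) by (apply le_INR; lia).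
split.
- eapply Rle_trans; [|exact H1]; apply Rmult_le_pos; [apply pos_INR|lra].
- eapply Rle_trans; [exact H2|].
  apply Rmult_le_reg_r with (INR m); [assumption|].
  unfold Rdiv; rewrite Rmult_assoc, Rinv_l; lra.
Qed.

Lemma fkernels_far s M m x d tau : (1 <= M)%nat -> (M <= m)%nat -> in_cube s x -> 0 <= tau ->
  (forall a t, 0 <= a <= 1 -> 0 <= t <= 1 -> d < Rabs (a - t) -> fkernel M a t <= tau) ->
  rsum (fun i => fkernels M x (map (midpt m) i) * far d x (map (midpt m) i)) (tuples s m)
    <= INR s * tau * INR m ^ s.
Proof.
intros HM Hm Hx Htau tail; revert x Hx; induction s as [|s IH]; intros x Hx.
- destruct Hx as [Hl _]; destruct x; [|discriminate].
  unfold rsum, fkernels, far; simpl; unfold rsum; simpl; lra.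
- destruct x as [|a x]; [destruct Hx; discriminate|].
  apply in_cube_cons in Hx; destruct Hx as [Ha Hx].
  assert (Hlen : length x = s) by apply Hx.
  pose (ind := fun i => fkernel M a (midpt m i) * (if Rle_dec (Rabs (a - midpt m i)) d then 0 else 1)).
  pose (T := rsum (fun i => fkernels M x (map (midpt m) i) * far d x (map (midpt m) i)) (tuples s m)).
  rewrite rsum_tuples_S.
  rewrite (rsum_ext _ (fun i => INR m ^ s * ind i + T * fkernel M a (midpt m i))).
  + rewrite rsum_plus, !rsum_scal, fkernel_mean by assumption.
    assert (I1 : rsum ind (seq 0 m) <= INR m * tau).
    { rewrite <- (length_seq m 0), <- rsum_const, length_seq; apply rsum_le.
      intros i Hi; apply in_seq in Hi; unfold ind; destruct Rle_dec as [|n]; [lra|].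
      rewrite Rmult_1_r; apply tail; [assumption|apply midpt_unit; lia|lra]. }
    assert (I2 : T <= INR s * tau * INR m ^ s) by now apply IH.
    assert (0 <= INR m ^ s) by (apply pow_le, pos_INR).
    assert (0 <= INR m) by apply pos_INR.
    rewrite S_INR; simpl pow.
    replace ((INR s + 1) * tau * (INR m * INR m ^ s)) with
      (INR m ^ s * (INR m * tau) + (INR s * tau * INR m ^ s) * INR m) by ring.
    apply Rplus_le_compat; [now apply Rmult_le_compat_l|now apply Rmult_le_compat_r].
  + intros i _; unfold T; rewrite <- (fkernels_mean s M m x) by assumption.
    rewrite (Rmult_comm _ (ind i)), (Rmult_comm (rsum _ _) (fkernel _ _ _)), <- !rsum_scal, <- rsum_plus.
    apply rsum_ext; intros is _; unfold ind, fkernels, far; simpl; rewrite rsum_cons; simpl; ring.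
Qed.

Lemma mids_cube s m i : In i (tuples s m) -> in_cube s (map (midpt m) i).
Proof.
intros Hi; apply tuples_In in Hi; destruct Hi as [Hl Hf]; split; [now rewrite length_map|].
rewrite Forall_map; eapply Forall_impl; [|exact Hf]; intros j Hj; now apply midpt_unit.
Qed.

(** The kernel is positive with mean one. [E] is the oscillation of [g] between points close in
    every coordinate, [D] the price of each far coordinate, whose mass [fkernels_far] bounds. *)
Lemma fejer_mean_error s M m g D E d tau x : (1 <= M)%nat -> (M <= m)%nat -> in_cube s x -> 0 <= tau ->
  0 <= D ->
  (forall a t, 0 <= a <= 1 -> 0 <= t <= 1 -> d < Rabs (a - t) -> fkernel M a t <= tau) ->
  (forall y, in_cube s y -> Rabs (g x - g y) <= E + D * far d x y) ->
  Rabs (g x - / (INR m ^ s) * rsum (fun i => g (map (midpt m) i) * fkernels M x (map (midpt m) i)) (tuples s m))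
    <= E + D * (INR s * tau).
Proof.
intros HM Hm Hx Htau HD tail mod_.
assert (mp : 0 < INR m ^ s) by (apply pow_INR_pos; lia).
assert (Hlen : length x = s) by apply Hx.
assert (mean := fkernels_mean s M m x HM Hm Hlen).
assert (farb := fkernels_far s M m x d tau HM Hm Hx Htau tail).
pose (K := fun i => fkernels M x (map (midpt m) i)).
change (rsum K (tuples s m) = INR m ^ s) in mean.
change (rsum (fun i => K i * far d x (map (midpt m) i)) (tuples s m) <= INR s * tau * INR m ^ s) in farb.
change (Rabs (g x - / (INR m ^ s) * rsum (fun i => g (map (midpt m) i) * K i) (tuples s m))
    <= E + D * (INR s * tau)).
assert (Eq : g x - / INR m ^ s * rsum (fun i => g (map (midpt m) i) * K i) (tuples s m) =
  / INR m ^ s * rsum (fun i => (g x - g (map (midpt m) i)) * K i) (tuples s m)).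
{ rewrite (rsum_ext (fun i => (g x - g (map (midpt m) i)) * K i)
    (fun i => g x * K i - g (map (midpt m) i) * K i)) by (intros; ring).
  rewrite rsum_minus, rsum_scal, mean; field; lra. }
rewrite Eq, Rabs_mult, (Rabs_right (/ _)) by (left; now apply Rinv_0_lt_compat).
apply Rmult_le_reg_l with (INR m ^ s); [assumption|].
rewrite <- Rmult_assoc, Rinv_r, Rmult_1_l by lra.
eapply Rle_trans; [apply rsum_abs|].
apply Rle_trans with (rsum (fun i => E * K i + D * (K i * far d x (map (midpt m) i))) (tuples s m)).
- apply rsum_le; intros i Hi.
  assert (0 <= K i) by now apply fkernels_nonneg.
  rewrite Rabs_mult, (Rabs_right (K i)) by lra.
  replace (E * K i + D * (K i * far d x (map (midpt m) i))) with
    ((E + D * far d x (map (midpt m) i)) * K i) by ring.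
  apply Rmult_le_compat_r; [assumption|]; apply mod_; now apply mids_cube.
- rewrite rsum_plus, !rsum_scal, mean.
  apply Rle_trans with (E * INR m ^ s + D * (INR s * tau * INR m ^ s)); [|right; ring].
  apply Rplus_le_compat_l, Rmult_le_compat_l; assumption.
Qed.

Lemma finite_uniform {A} (P : A -> nat -> Prop) l :
  (forall a, In a l -> exists m0, forall m, (m0 <= m)%nat -> P a m) ->
  exists m0, forall m, (m0 <= m)%nat -> forall a, In a l -> P a m.
Proof.
induction l as [|a l IH]; intros H; [exists 0%nat; intros m _ b []|].
destruct (H a) as [m1 H1]; [now left|].
destruct IH as [m2 H2]; [intros b Hb; apply H; now right|].
exists (Nat.max m1 m2); intros m Hm b [<-|Hb]; [apply H1; lia|apply H2; [lia|assumption]].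
Qed.

Lemma Rabs_sigma_le k x : Rabs (sigma k x) <= 2 ^ length k.
Proof.
revert x; induction k as [|k ks IH]; intros x.
- unfold sigma; simpl; rewrite Rabs_R1; lra.
- destruct x as [|a x].
  + unfold sigma; simpl combine; simpl; rewrite Rabs_R1.
    change (2 * 2 ^ length ks) with (2 ^ S (length ks)); apply pow_R1_Rle; lra.
  + change (sigma (k :: ks) (a :: x)) with (sigma1 k a * sigma ks x); rewrite Rabs_mult; simpl.
    apply Rmult_le_compat; try apply Rabs_pos; [|apply IH].
    destruct k as [|k]; unfold sigma1; [rewrite Rabs_R1; lra|].
    rewrite Rabs_mult, (Rabs_right (sqrt 2)) by (apply Rle_ge, sqrt_pos).
    assert (sqrt 2 <= 2) by (apply Rsqr_incr_0_var; [rewrite Rsqr_sqrt; unfold Rsqr; lra|lra]).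
    assert (0 <= sqrt 2) by apply sqrt_pos.
    assert (Rabs (cos (PI * INR (S k) * a)) <= 1) by (apply Rabs_le; apply COS_bound).
    assert (0 <= Rabs (cos (PI * INR (S k) * a))) by apply Rabs_pos; nra.
Qed.

Lemma fws_bounds M k : Forall (fun i => (i < M)%nat) k -> 0 <= fws M k <= 1.
Proof.
induction 1 as [|i k Hi Hk IH]; unfold fws; simpl; [lra|fold (fws M k)].
destruct (fw_bounds M i Hi); nra.
Qed.

Lemma nth_map_lt {A B} (f : A -> B) l j a b : (j < length l)%nat -> nth j (map f l) b = f (nth j l a).
Proof. intros Hj; rewrite (nth_indep _ b (f a)) by now rewrite length_map. apply map_nth. Qed.

Lemma midpt_riemann s f I eps : is_integral s f I -> 0 < eps ->
  exists m0, forall m, (m0 <= m)%nat -> (1 <= m)%nat ->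
    Rabs (/ (INR m ^ s) * rsum (fun i => f (map (midpt m) i)) (tuples s m) - I) < eps.
Proof.
intros HI He; destruct (HI eps He) as [m0 H]; exists m0; intros m Hm H1.
apply (H m (map (midpt m))); try assumption.
intros i Hi; apply tuples_In in Hi; destruct Hi as [Hl Hf]; split; [now rewrite length_map|].
intros j Hj; rewrite (nth_map_lt _ _ _ 0%nat) by lia; now apply midpt_cell.
Qed.

Lemma far_nonneg d x y : 0 <= far d x y.
Proof. apply rsum_nonneg; intros a _; destruct Rle_dec; lra. Qed.

Lemma far_close d x y : length x = length y -> close d x y \/ 1 <= far d x y.
Proof.
revert y; induction x as [|a x IH]; intros [|b y] Hl; try discriminate; [left; constructor|].
simpl in Hl; unfold far; simpl combine; rewrite rsum_cons; fold (far d x y); simpl.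
destruct Rle_dec as [H|H].
- destruct (IH y) as [C|C]; [congruence|left; now constructor|right; lra].
- right; generalize (far_nonneg d x y); lra.
Qed.

Lemma close_unit s x y : in_cube s x -> in_cube s y -> close 1 x y.
Proof.
revert x y; induction s as [|s IH]; intros [|a x] [|b y] Hx Hy;
  try (destruct Hx; destruct Hy; discriminate); [constructor|].
apply in_cube_cons in Hx; apply in_cube_cons in Hy.
constructor; [apply Rabs_le; lra|apply IH; tauto].
Qed.

(** With midpoint sums [Q k] in place of [c k], the Fejer mean is within [2 * eps / 3] of [g] by the
    kernel estimate; a fine mesh then brings [Q k] close to [c k] for the finitely many [k]
    involved. The choices are made in the order [d], [M], [m]. *)
Lemma fejer_means_converge s alpha p g c L eps : 0 < alpha -> valid_p p -> 0 <= L ->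
  holder_bound s alpha p g L ->
  (forall k, length k = s -> is_integral s (fun x => g x * sigma k x) (c k)) -> 0 < eps ->
  exists M, (1 <= M)%nat /\ forall x, in_cube s x ->
    Rabs (g x - rsum (fun k => fws M k * c k * sigma k x) (tuples s M)) <= eps.
Proof.
intros Ha Hp HL Hh Hc He.
set (D := L * s_pow s alpha p).
assert (HD : 0 <= D) by (apply Rmult_le_pos; [assumption|left; apply s_pow_pos]).
(* [D + 1] keeps the quotient defined when [D = 0]; the bound [1 / 2] keeps [sin (PI * d / 2)]
   positive. *)
set (d := Rmin (Rpower (eps / (3 * (D + 1))) (/ alpha)) (1 / 2)).
assert (Hd : 0 < d) by (apply Rmin_pos; [apply exp_pos|lra]).
assert (Hd2 : d <= 1 / 2) by apply Rmin_r.
assert (e1 : 0 < eps / (3 * (D + 1))) by (apply Rdiv_lt_0_compat; lra).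
assert (dD : D * Rpower d alpha <= eps / 3).
{ assert (Rpower d alpha <= eps / (3 * (D + 1))).
  { apply Rle_trans with (Rpower (Rpower (eps / (3 * (D + 1))) (/ alpha)) alpha).
    - apply Rle_Rpower_l; [lra|split; [assumption|apply Rmin_l]].
    - rewrite Rpower_mult, Rinv_l, Rpower_1; lra. }
  assert (0 < Rpower d alpha) by apply exp_pos.
  apply Rle_trans with ((D + 1) * (eps / (3 * (D + 1)))); [nra|right; field; lra]. }
set (sd := sin (PI * d / 2) ^ 2).
assert (P := PI_RGT_0).
assert (Hsd : 0 < sd) by (apply pow_lt, sin_gt_0; nra).
destruct (INR_unbounded (D * INR s / sd * (3 / eps))) as [M0 HM0].
set (M := S M0); exists M; split; [unfold M; lia|].
assert (HM : 0 < INR M) by (apply lt_0_INR; unfold M; lia).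
set (tau := / (INR M * sd)).
assert (Htau : 0 < tau) by (apply Rinv_0_lt_compat, Rmult_lt_0_compat; assumption).
assert (tauD : D * (INR s * tau) <= eps / 3).
{ assert (D * INR s / sd * (3 / eps) <= INR M) by (unfold M; rewrite S_INR; lra).
  assert (D * INR s / sd <= INR M * (eps / 3)).
  { apply Rmult_le_reg_r with (3 / eps); [apply Rdiv_lt_0_compat; lra|].
    eapply Rle_trans; [eassumption|]; right; field; lra. }
  apply Rmult_le_reg_l with (INR M); [assumption|].
  eapply Rle_trans; [|eassumption]; right; unfold tau; field; lra. }
(* The number of frequencies times a bound for [|sigma k x|]. *)
set (C := INR M ^ s * 2 ^ s).
assert (HC : 0 < C) by (apply Rmult_lt_0_compat; apply pow_lt; lra).
destruct (finite_uniform (fun k m => (1 <= m)%nat ->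
   Rabs (/ (INR m ^ s) * rsum (fun i => g (map (midpt m) i) * sigma k (map (midpt m) i)) (tuples s m) - c k)
     < eps / (3 * C)) (tuples s M)) as [m0 Hm0].
{ intros k Hk; apply tuples_In in Hk; destruct Hk as [Hk _].
  destruct (midpt_riemann s (fun x => g x * sigma k x) (c k) (eps / (3 * C))) as [m0 H];
    [now apply Hc|apply Rdiv_lt_0_compat; lra|].
  exists m0; intros m Hm H1; now apply H. }
set (m := Nat.max m0 M).
assert (Hm : (M <= m)%nat) by (unfold m; lia).
intros x Hx.
assert (mp : 0 < INR m ^ s) by (apply pow_INR_pos; unfold m, M; lia).
assert (B1 := fejer_mean_error s M m g D (D * Rpower d alpha) d tau x).
specialize (B1 ltac:(unfold M; lia) Hm Hx (Rlt_le _ _ Htau) HD).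
assert (B1' := B1 (fun a t Ha' Ht' => fkernel_tail M a t d ltac:(unfold M; lia) Ha' Ht' Hd)); clear B1.
assert (mod_ : forall y, in_cube s y -> Rabs (g x - g y) <= D * Rpower d alpha + D * far d x y).
{ intros y Hy.
  assert (0 < Rpower d alpha) by apply exp_pos.
  assert (F0 := far_nonneg d x y).
  destruct (far_close d x y) as [Hcl|Hf]; [destruct Hx, Hy; congruence| |].
  - assert (H1 := holder_close s alpha p g L d y x Ha Hp Hd HL Hh Hy Hx Hcl).
    fold D in H1; nra.
  (* Points of the cube differ by at most [1] in each coordinate, so [D] bounds the difference, and
     [far] is at least [1] here. *)
  - assert (H1 := holder_close s alpha p g L 1 y x Ha Hp Rlt_0_1 HL Hh Hy Hx (close_unit _ _ _ Hx Hy)).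
    fold D in H1.
    replace (Rpower 1 alpha) with 1 in H1 by (unfold Rpower; rewrite ln_1, Rmult_0_r, exp_0; reflexivity).
    nra. }
specialize (B1' mod_).
assert (Eq : / INR m ^ s * rsum (fun i => g (map (midpt m) i) * fkernels M x (map (midpt m) i)) (tuples s m)
  = rsum (fun k => fws M k * (/ (INR m ^ s) *
      rsum (fun i => g (map (midpt m) i) * sigma k (map (midpt m) i)) (tuples s m)) * sigma k x) (tuples s M)).
{ rewrite (rsum_ext (fun i => g (map (midpt m) i) * fkernels M x (map (midpt m) i))
    (fun i => rsum (fun k => fws M k * sigma k x * (g (map (midpt m) i) * sigma k (map (midpt m) i))) (tuples s M))).
  - rewrite rsum_swap, <- rsum_scal; apply rsum_ext; intros k _; rewrite rsum_scal; ring.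
  - intros i Hi; apply tuples_In in Hi.
    rewrite <- (fkernels_expand s) by (destruct Hx; rewrite ?length_map; tauto).
    rewrite <- rsum_scal; apply rsum_ext; intros k _; ring. }
rewrite Eq in B1'.
pose (Q := fun k => / (INR m ^ s) * rsum (fun i => g (map (midpt m) i) * sigma k (map (midpt m) i)) (tuples s m)).
change (Rabs (g x - rsum (fun k => fws M k * Q k * sigma k x) (tuples s M))
  <= D * Rpower d alpha + D * (INR s * tau)) in B1'.
assert (B2 : Rabs (rsum (fun k => fws M k * Q k * sigma k x) (tuples s M) -
   rsum (fun k => fws M k * c k * sigma k x) (tuples s M)) <= eps / 3).
{ rewrite <- rsum_minus.
  eapply Rle_trans; [apply rsum_abs|].
  apply Rle_trans with (rsum (fun _ => 2 ^ s * (eps / (3 * C))) (tuples s M)).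
  - apply rsum_le; intros k Hk.
    assert (Hq := Hm0 m ltac:(unfold m; lia) k Hk ltac:(unfold m, M; lia)).
    change (Rabs (Q k - c k) < eps / (3 * C)) in Hq.
    apply tuples_In in Hk; destruct Hk as [Hk Hkf].
    assert (W := fws_bounds M k Hkf); assert (Sg := Rabs_sigma_le k x); rewrite Hk in Sg.
    replace (fws M k * Q k * sigma k x - fws M k * c k * sigma k x) with
      (fws M k * (sigma k x * (Q k - c k))) by ring.
    rewrite !Rabs_mult, (Rabs_right (fws M k)) by lra.
    assert (0 <= Rabs (sigma k x) * Rabs (Q k - c k)) by (apply Rmult_le_pos; apply Rabs_pos).
    apply Rle_trans with (Rabs (sigma k x) * Rabs (Q k - c k)); [nra|].
    apply Rmult_le_compat; try apply Rabs_pos; [assumption|lra].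
  - rewrite rsum_tuples_const; right; unfold C; field; split; apply pow_nonzero; lra. }
replace (g x - rsum (fun k => fws M k * c k * sigma k x) (tuples s M)) with
 ((g x - rsum (fun k => fws M k * Q k * sigma k x) (tuples s M)) +
  (rsum (fun k => fws M k * Q k * sigma k x) (tuples s M) -
   rsum (fun k => fws M k * c k * sigma k x) (tuples s M))) by ring.
eapply Rle_trans; [apply Rabs_triang|]; lra.
Qed.

(** * Character sums over the point set and over the grid *)

Definition cosN (N a : nat) : R := cos (2 * PI * INR a / INR N).

Lemma cosN_mod N a b : (1 <= N)%nat -> cosN N (a + N * b) = cosN N a.
Proof.
intros HN; assert (0 < INR N) by (apply lt_0_INR; lia).
unfold cosN; rewrite plus_INR, mult_INR.
replace (2 * PI * (INR a + INR N * INR b) / INR N) with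
  (2 * PI * INR a / INR N + 2 * INR b * PI) by (field; lra).
apply cos_period.
Qed.

Lemma cosN_0 N : cosN N 0 = 1.
Proof. unfold cosN; simpl; rewrite Rmult_0_r; unfold Rdiv; rewrite Rmult_0_l; apply cos_0. Qed.

Definition node (N i : nat) : R := phi (INR i / INR N).

Lemma frac_part_INR N a : (1 <= N)%nat -> frac_part (INR a / INR N) = INR (a mod N) / INR N.
Proof.
intros HN; assert (0 < INR N) by (apply lt_0_INR; lia).
assert (E : INR a = INR N * INR (a / N) + INR (a mod N)).
{ rewrite <- mult_INR, <- plus_INR, <- Nat.div_mod_eq; reflexivity. }
assert (Hlt : INR (a mod N) < INR N) by (apply lt_INR, Nat.mod_upper_bound; lia).
assert (Hge : 0 <= INR (a mod N)) by apply pos_INR.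
assert (E2 : INR a / INR N = INR (a / N) + INR (a mod N) / INR N) by (rewrite E; field; lra).
assert (0 <= INR (a mod N) / INR N < 1).
{ split; [apply Rmult_le_pos; [lra|left; now apply Rinv_0_lt_compat]|].
  apply Rmult_lt_reg_r with (INR N); [assumption|].
  unfold Rdiv; rewrite Rmult_assoc, Rinv_l; lra. }
unfold frac_part.
rewrite <- (Int_part_spec (INR a / INR N) (Z.of_nat (a / N))); rewrite <- INR_IZR_INZ, E2; lra.
Qed.

Lemma ypt_node N s n : (1 <= N)%nat -> ypt N s n = map (fun j => node N ((n ^ j) mod N)) (seq 1 s).
Proof.
intros HN; unfold ypt, node; apply map_ext; intros j; now rewrite frac_part_INR.
Qed.

Lemma node_unit N i : (i < N)%nat -> 0 <= node N i <= 1.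
Proof.
intros Hi; assert (0 < INR N) by (apply lt_0_INR; lia).
assert (0 <= INR i / INR N <= 1).
{ assert (0 <= INR i <= INR N) by (split; [apply pos_INR|apply le_INR; lia]).
  split; [apply Rmult_le_pos; [lra|left; now apply Rinv_0_lt_compat]|].
  apply Rmult_le_reg_r with (INR N); [assumption|].
  unfold Rdiv; rewrite Rmult_assoc, Rinv_l; lra. }
unfold node, phi, Rabs; destruct Rcase_abs; lra.
Qed.

Definition amp (k : nat) : R := match k with O => 1 | S _ => sqrt 2 end.
(** The weight [2^(|u|/2)] of the norm, for [u] the support of [k]. *)
Definition amps (k : list nat) : R := fold_right Rmult 1 (map amp k).

Lemma amp_nonneg k : 0 <= amp k.
Proof. destruct k; simpl; [lra|apply sqrt_pos]. Qed.

Lemma amps_nonneg k : 0 <= amps k.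
Proof.
induction k as [|k ks IH]; unfold amps; simpl; [lra|].
apply Rmult_le_pos; [apply amp_nonneg|apply IH].
Qed.

(** On either branch of the tent map [cos (PI k phi(t)) = cos (2 PI k t)]; the right branch uses
    parity and period. *)
Lemma sigma1_node N i k : (i < N)%nat -> sigma1 k (node N i) = amp k * cosN N (k * i).
Proof.
intros Hi; assert (HN : 0 < INR N) by (apply lt_0_INR; lia).
destruct k as [|k]; [simpl; rewrite cosN_0; ring|].
unfold sigma1, amp; f_equal; unfold node, phi, cosN; rewrite mult_INR.
set (t := INR i / INR N).
replace (2 * PI * (INR (S k) * INR i) / INR N) with (PI * INR (S k) * (2 * t)) by (unfold t; field; lra).
unfold Rabs; destruct Rcase_abs.
- f_equal; ring.
- rewrite <- (cos_neg (PI * INR (S k) * (2 * t))), <- (cos_period (- (PI * INR (S k) * (2 * t))) (S k)); f_equal; ring.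
Qed.

Lemma cosN_mul_mod N k a : (1 <= N)%nat -> cosN N (k * (a mod N)) = cosN N (k * a).
Proof.
intros HN; rewrite (Nat.div_mod_eq a N) at 2.
replace (k * (N * (a / N) + a mod N))%nat with (k * (a mod N) + N * (k * (a / N)))%nat by ring.
now rewrite cosN_mod.
Qed.

Fixpoint cosprod (N : nat) (ks : list nat) (j n : nat) : R :=
  match ks with nil => 1 | k :: ks' => cosN N (k * n ^ j) * cosprod N ks' (S j) n end.

Lemma sigma_nodes N ks j n : (1 <= N)%nat ->
  sigma ks (map (fun j => node N ((n ^ j) mod N)) (seq j (length ks))) = amps ks * cosprod N ks j n.
Proof.
intros HN; revert j; induction ks as [|k ks IH]; intros j; [unfold sigma, amps; simpl; ring|].
transitivity (sigma1 k (node N ((n ^ j) mod N)) *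
  sigma ks (map (fun j => node N ((n ^ j) mod N)) (seq (S j) (length ks)))); [reflexivity|].
rewrite IH, sigma1_node, cosN_mul_mod by (try apply Nat.mod_upper_bound; lia).
change (amps (k :: ks)) with (amp k * amps ks).
change (cosprod N (k :: ks) j n) with (cosN N (k * n ^ j) * cosprod N ks (S j) n); ring.
Qed.

Fixpoint signed_sum (e : nat -> nat) (ks : list nat) (j n : nat) : nat :=
  match ks with nil => 0 | k :: ks' => e j * k * n ^ j + signed_sum e ks' (S j) n end%nat.

Lemma signed_sum_ext e e' ks j n : (forall i, (j <= i)%nat -> e i = e' i) ->
  signed_sum e ks j n = signed_sum e' ks j n.
Proof.
revert j; induction ks as [|k ks IH]; intros j H; [reflexivity|].
simpl; rewrite (H j), (IH (S j)); [reflexivity|intros; apply H; lia|lia].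
Qed.

(* [e i] is a sign: [N - 1] stands for [-1] modulo [N]. *)
Lemma cosprod_bound N ks B : (1 <= N)%nat -> forall j f,
  (forall e, (forall i, e i = 1 \/ e i = N - 1)%nat ->
    Rabs (rsum (fun n => cosN N (f n + signed_sum e ks j n)) (seq 0 N)) <= B) ->
  Rabs (rsum (fun n => cosN N (f n) * cosprod N ks j n) (seq 0 N)) <= B.
Proof.
intros HN; induction ks as [|k ks IH]; intros j f H.
- rewrite (rsum_ext _ (fun n => cosN N (f n + signed_sum (fun _ => 1%nat) nil j n))).
  + apply H; auto.
  + intros n _; simpl; rewrite Nat.add_0_r; ring.
(* The product of two cosines is the mean of the cosines of sum and difference; [f] accumulates the
   signs chosen so far. *)
- rewrite (rsum_ext _ (fun n => / 2 * (cosN N (f n + k * n ^ j) * cosprod N ks (S j) n +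
     cosN N (f n + (N - 1) * k * n ^ j) * cosprod N ks (S j) n))).
  + rewrite rsum_scal, rsum_plus, Rabs_mult, (Rabs_right (/ 2)) by lra.
    assert (Hc : forall c, (c = 1 \/ c = N - 1)%nat ->
      Rabs (rsum (fun n => cosN N (f n + c * k * n ^ j) * cosprod N ks (S j) n) (seq 0 N)) <= B).
    { intros c Hc; apply (IH (S j) (fun n => (f n + c * k * n ^ j)%nat)); intros e He.
      set (e' := fun i => if Nat.eqb i j then c else e i).
      rewrite (rsum_ext _ (fun n => cosN N (f n + signed_sum e' (k :: ks) j n))).
      - apply H; intros i; unfold e'; destruct Nat.eqb; auto.
      - intros n _; f_equal; simpl; unfold e' at 1; rewrite Nat.eqb_refl.
        rewrite (signed_sum_ext e' e); [lia|].
        intros i Hi; unfold e'; destruct (Nat.eqb_spec i j); [lia|reflexivity]. }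
    assert (H1 := Hc 1%nat (or_introl eq_refl)); assert (H2 := Hc (N - 1)%nat (or_intror eq_refl)).
    rewrite (rsum_ext _ (fun n => cosN N (f n + k * n ^ j) * cosprod N ks (S j) n)) in H1
      by (intros n _; do 3 f_equal; lia).
    match goal with |- _ * Rabs (?a + ?b) <= _ => generalize (Rabs_triang a b) end; lra.
  + intros n _; simpl; set (F := f n); set (G := (k * n ^ j)%nat).
    replace ((N - 1) * k * n ^ j)%nat with ((N - 1) * G)%nat by (unfold G; ring).
    assert (E : cosN N (F + G) + cosN N (F + (N - 1) * G) = 2 * cosN N F * cosN N G).
    { assert (HN0 : 0 < INR N) by (apply lt_0_INR; lia).
      unfold cosN; rewrite !plus_INR, mult_INR, minus_INR by lia.
      replace (2 * PI * (INR F + (INR N - INR 1) * INR G) / INR N) with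
        ((2 * PI * INR F / INR N - 2 * PI * INR G / INR N) + 2 * INR G * PI) by (simpl; field; lra).
      replace (2 * PI * (INR F + INR G) / INR N) with
        (2 * PI * INR F / INR N + 2 * PI * INR G / INR N) by (field; lra).
      rewrite cos_period, cos_plus, cos_minus; ring. }
    rewrite <- Rmult_plus_distr_r, E; field.
Qed.

Lemma nat_poly_S a d n : nat_poly a (S d) n = (nat_poly a d n + a (S d) * n ^ S d)%nat.
Proof.
unfold nat_poly; rewrite (seq_S (S d) 0), map_app, fold_right_app.
generalize (seq 0 (S d)); intros l; induction l as [|x l IH]; simpl in *; [lia|].
rewrite IH; lia.
Qed.

(** Leading coefficients divisible by [N] vanish modulo [N] and are dropped until one is not; the
    bound for the lower degree is smaller. The condition [1 <= j] keeps the polynomial from being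
    constant. *)
Lemma weil_any N a s : prime (Z.of_nat N) -> (s < N)%nat ->
  (exists j, (1 <= j <= s)%nat /\ ~ Nat.divide N (a j)) ->
  Rabs (rsum (fun n => cosN N (nat_poly a s n)) (seq 0 N)) <= (INR s - 1) * sqrt (INR N).
Proof.
intros HN; assert (N1 : (1 <= N)%nat) by (apply prime_ge_2 in HN; lia).
induction s as [|s IH]; intros Hs [j [Hj Hd]]; [lia|].
destruct (Nat.eq_dec (a (S s) mod N) 0) as [E|E].
- apply Nat.Div0.mod_divides in E; destruct E as [q Eq].
  assert (j <> S s) by (intros ->; apply Hd; exists q; lia).
  rewrite (rsum_ext _ (fun n => cosN N (nat_poly a s n))).
  + eapply Rle_trans; [apply IH; [lia|exists j; split; [lia|assumption]]|].
    apply Rmult_le_compat_r; [apply sqrt_pos|rewrite S_INR; lra].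
  + intros n _; rewrite nat_poly_S, Eq, <- Nat.mul_assoc; now apply cosN_mod.
- apply (@WeilBound.weil_cos_sum N a (S s)); [assumption|lia|assumption|].
  intros [q Eq]; apply E; rewrite Eq; apply Nat.Div0.mod_mul.
Qed.

Lemma signed_sum_nat_poly e ks : exists a,
  (forall j, (j < length ks)%nat -> a (S j) = (e (S j) * nth j ks 0)%nat) /\
  forall n, signed_sum e ks 1 n = nat_poly a (length ks) n.
Proof.
pose (a := fun j => match j with O => O | S i => (e (S i) * nth i ks 0)%nat end).
assert (H : forall n, signed_sum e ks 1 n = nat_poly a (length ks) n).
{ intros n; unfold nat_poly.
  change (seq 0 (S (length ks))) with (0%nat :: seq 1 (length ks)); simpl.
  assert (G : forall l j0 (b : nat -> nat), (forall i, (i < length l)%nat -> b (j0 + i)%nat = (e (j0 + i) * nth i l 0)%nat) ->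
    signed_sum e l j0 n = fold_right Nat.add 0%nat (map (fun j => (b j * n ^ j)%nat) (seq j0 (length l)))).
  { induction l as [|k l IH]; intros j0 b Hb; [reflexivity|].
    simpl; rewrite (IH (S j0) b).
    - assert (Hb0 := Hb 0%nat); rewrite Nat.add_0_r in Hb0; simpl in Hb0; rewrite Hb0 by lia; reflexivity.
    - intros i Hi; assert (Hbi := Hb (S i)); simpl in Hbi.
      replace (S j0 + i)%nat with (j0 + S i)%nat by lia; apply Hbi; lia. }
  rewrite <- (G ks 1%nat a); [reflexivity|]; intros i Hi; reflexivity. }
exists a; split; [reflexivity|apply H].
Qed.

Lemma qmc_sigma_bound N s ks : prime (Z.of_nat N) -> (s < N)%nat -> length ks = s ->
  Exists (fun k => ~ Nat.divide N k) ks ->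
  Rabs (qmc_avg N s (sigma ks)) <= amps ks * ((INR s - 1) / sqrt (INR N)).
Proof.
intros HN Hs Hl He.
assert (N2 : (2 <= N)%nat) by (apply prime_ge_2 in HN; lia).
assert (HN0 : 0 < INR N) by (apply lt_0_INR; lia).
assert (sN : 0 < sqrt (INR N)) by now apply sqrt_lt_R0.
assert (B : Rabs (rsum (fun n => cosN N 0 * cosprod N ks 1 n) (seq 0 N)) <= (INR s - 1) * sqrt (INR N)).
{ apply (cosprod_bound N ks _ ltac:(lia) 1%nat (fun _ => 0%nat)); intros e Hsign.
  destruct (signed_sum_nat_poly e ks) as [a [Ha Hsum]].
  rewrite (rsum_ext _ (fun n => cosN N (nat_poly a s n))) by (intros n _; rewrite <- Hl, <- Hsum; reflexivity).
  apply weil_any; [assumption|assumption|].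
  apply Exists_exists in He; destruct He as [k [Hk Hd]].
  destruct (In_nth ks k 0%nat Hk) as [j [Hj Hjk]].
  exists (S j); split; [lia|]; rewrite Ha by assumption; rewrite Hjk.
  destruct (Hsign (S j)) as [->| ->]; [now rewrite Nat.mul_1_l|].
  (* From [(N - 1) * k = q * N] follows [k = (k - q) * N]. *)
  intros [q Eq]; apply Hd; exists (k - q)%nat.
  rewrite Nat.mul_sub_distr_r, <- Eq, Nat.mul_sub_distr_r; nia. }
unfold qmc_avg.
rewrite (rsum_ext _ (fun n => amps ks * (cosN N 0 * cosprod N ks 1 n))).
- rewrite rsum_scal, !Rabs_mult, (Rabs_right (/ INR N)), (Rabs_right (amps ks));
    [|apply Rle_ge, amps_nonneg|left; now apply Rinv_0_lt_compat].
  apply Rle_trans with (/ INR N * (amps ks * ((INR s - 1) * sqrt (INR N)))).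
  + apply Rmult_le_compat_l; [left; now apply Rinv_0_lt_compat|].
    apply Rmult_le_compat_l; [apply amps_nonneg|exact B].
  + right; rewrite <- (sqrt_sqrt (INR N)) at 1 by lra; field; lra.
- intros n _; rewrite ypt_node, <- Hl, sigma_nodes by lia; rewrite cosN_0; ring.
Qed.

Definition grid_avg (N s : nat) (g : list R -> R) : R :=
  / (INR N ^ s) * rsum (fun i => g (map (node N) i)) (tuples s N).

Lemma grid_sigma_zero N s ks : prime (Z.of_nat N) -> length ks = s ->
  Exists (fun k => ~ Nat.divide N k) ks -> grid_avg N s (sigma ks) = 0.
Proof.
intros HN Hl He; assert (N2 : (2 <= N)%nat) by (apply prime_ge_2 in HN; lia).
assert (one : forall k, ~ Nat.divide N k -> rsum (fun i => sigma1 k (node N i)) (seq 0 N) = 0).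
{ intros k Hk.
  (* in degree one the bound of [weil_any] is [0] *)
  assert (W := weil_any N (fun j => match j with O => O | S _ => k end) 1 HN ltac:(lia)
    (ex_intro _ 1%nat (conj (conj (le_n 1) (le_n 1)) Hk))).
  simpl (INR 1) in W; rewrite Rminus_diag, Rmult_0_l in W.
  rewrite (rsum_ext _ (fun i => amp k * cosN N (nat_poly (fun j => match j with O => O | S _ => k end) 1 i))).
  - rewrite rsum_scal; apply Rmult_eq_0_compat_l.
    unfold Rabs in W; destruct Rcase_abs in W; lra.
  - intros i Hi; apply in_seq in Hi; rewrite sigma1_node by lia; do 2 f_equal.
    unfold nat_poly; simpl; lia. }
assert (Z : rsum (fun i => sigma ks (map (node N) i)) (tuples s N) = 0).
{ revert s Hl; induction He as [k ks Hk|k ks He IH]; intros [|s] Hl; try discriminate;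
    rewrite rsum_tuples_S.
  - rewrite (rsum_ext _ (fun i => rsum (fun t => sigma ks (map (node N) t)) (tuples s N) * sigma1 k (node N i))).
    + rewrite rsum_scal, one by assumption; ring.
    + intros i _; rewrite Rmult_comm, <- rsum_scal; reflexivity.
  - rewrite (rsum_ext _ (fun i => 0)); [rewrite rsum_const; ring|].
    intros i _; transitivity (sigma1 k (node N i) * rsum (fun t => sigma ks (map (node N) t)) (tuples s N)).
    + rewrite <- rsum_scal; reflexivity.
    + rewrite IH by (simpl in Hl; congruence); ring. }
unfold grid_avg; rewrite Z; ring.
Qed.

Lemma sigma_nodes_dvd N ks t : Forall (Nat.divide N) ks -> Forall (fun i => (i < N)%nat) t ->
  length t = length ks -> sigma ks (map (node N) t) = amps ks.
Proof.
intros Hk; revert t; induction Hk as [|k ks [q Hq] Hk IH]; intros [|i t] Ht Hl; try discriminate;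
  [reflexivity|].
inversion Ht; subst.
change (sigma1 (q * N) (node N i) * sigma ks (map (node N) t) = amp (q * N) * amps ks).
rewrite IH, sigma1_node by (try assumption; simpl in Hl; congruence).
replace (q * N * i)%nat with (0 + N * (q * i))%nat by ring.
rewrite cosN_mod by lia; rewrite cosN_0; ring.
Qed.

Lemma qmc_grid_sigma N s ks : prime (Z.of_nat N) -> (1 <= s)%nat -> (s < N)%nat -> length ks = s ->
  Rabs (qmc_avg N s (sigma ks) - grid_avg N s (sigma ks)) <= amps ks * ((INR s - 1) / sqrt (INR N)).
Proof.
intros HN Hs1 Hs Hl; assert (N2 : (2 <= N)%nat) by (apply prime_ge_2 in HN; lia).
assert (HN0 : 0 < INR N) by (apply lt_0_INR; lia).
destruct (Exists_dec (fun k => ~ Nat.divide N k) ks) as [He|Hne].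
{ intros k; destruct (Nat.eq_dec (k mod N) 0) as [E|E].
  - right; intros H; apply H; now apply Nat.Lcm0.mod_divide.
  - left; intros H; apply E; now apply Nat.Lcm0.mod_divide. }
- rewrite grid_sigma_zero, Rminus_0_r by assumption; now apply qmc_sigma_bound.
- assert (Hd : Forall (Nat.divide N) ks).
  { apply Forall_forall; intros k Hk; destruct (Nat.eq_dec (k mod N) 0) as [E|E].
    - now apply Nat.Lcm0.mod_divide.
    - exfalso; apply Hne, Exists_exists; exists k; split; [assumption|].
      intros H; apply E; now apply Nat.Lcm0.mod_divide. }
  assert (Q : qmc_avg N s (sigma ks) = amps ks).
  { unfold qmc_avg; rewrite (rsum_ext _ (fun _ => amps ks)).
    - rewrite rsum_const, length_seq; field; lra.
    - intros n _; rewrite ypt_node by lia; rewrite <- (map_map (fun j => ((n ^ j) mod N)%nat) (node N)).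
      apply sigma_nodes_dvd; [assumption| |now rewrite length_map, length_seq].
      rewrite Forall_map; apply Forall_forall; intros j _; apply Nat.mod_upper_bound; lia. }
  assert (G : grid_avg N s (sigma ks) = amps ks).
  { unfold grid_avg; rewrite (rsum_ext _ (fun _ => amps ks)).
    - rewrite rsum_tuples_const; field; apply pow_nonzero; lra.
    - intros t Ht; apply tuples_In in Ht; apply sigma_nodes_dvd; [assumption|tauto|].
      destruct Ht; congruence. }
  rewrite Q, G, Rminus_diag, Rabs_R0; apply Rmult_le_pos; [apply amps_nonneg|].
  apply Rmult_le_pos; [|left; apply Rinv_0_lt_compat; now apply sqrt_lt_R0].
  assert (1 <= INR s) by (apply (le_INR 1); assumption); lra.
Qed.

(** * The grid as a tagged Riemann partition *)

(* the even endpoint of the cell [e/N, (e+1)/N] *)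
Definition cell_tag (N e : nat) : R := 2 * INR ((e + 1) / 2) / INR N.

Lemma cell_tag_cell N e : (1 <= N)%nat -> INR e / INR N <= cell_tag N e <= INR (S e) / INR N.
Proof.
intros HN; assert (0 < / INR N) by (apply Rinv_0_lt_compat, lt_0_INR; lia).
unfold cell_tag.
assert (E := Nat.div_mod_eq (e + 1) 2); assert (Hm := Nat.mod_upper_bound (e + 1) 2).
rewrite <- (mult_INR 2); unfold Rdiv.
split; apply Rmult_le_compat_r; try lra; apply le_INR; lia.
Qed.

(** The indices [i] and [N - i] give the same node, with even numerator; the smaller index takes the
    cell on its left, the larger one the cell on its right, and [0] takes cell [0]. *)
Definition cell_of (N i : nat) : nat :=
  if Nat.eqb i 0 then 0%nat else if Nat.leb (2 * i) N then (2 * i - 1)%nat else (2 * (N - i))%nat.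

Lemma node_cell_tag N i : (i < N)%nat -> node N i = cell_tag N (cell_of N i).
Proof.
intros Hi; assert (HN : 0 < INR N) by (apply lt_0_INR; lia).
assert (HNi : 0 < / INR N) by now apply Rinv_0_lt_compat.
assert (Hi0 : 0 <= INR i) by apply pos_INR.
unfold node, phi, cell_tag, cell_of.
replace (2 * (INR i / INR N) - 1) with ((2 * INR i - INR N) / INR N) by (field; lra).
destruct (Nat.eqb_spec i 0) as [->|Hz].
- simpl; unfold Rabs; destruct Rcase_abs as [_|H]; [field; lra|].
  exfalso; unfold Rdiv in H; nra.
- destruct (Nat.leb_spec (2 * i) N) as [H|H].
  + replace ((2 * i - 1 + 1) / 2)%nat with i
      by (replace (2 * i - 1 + 1)%nat with (i * 2)%nat by lia; now rewrite Nat.div_mul).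
    apply le_INR in H; rewrite mult_INR in H; simpl in H.
    rewrite Rabs_left1; [field; lra|]; unfold Rdiv; nra.
  + replace ((2 * (N - i) + 1) / 2)%nat with (N - i)%nat
      by (apply (Nat.div_unique _ 2 _ 1); lia).
    apply lt_INR in H; rewrite mult_INR in H; simpl in H; rewrite minus_INR by lia.
    rewrite Rabs_right; [field; lra|]; unfold Rdiv; nra.
Qed.

(** One branch yields odd cells, the other positive even ones, so [cell_of] is injective. *)
Lemma cell_of_perm N : Permutation (map (cell_of N) (seq 0 N)) (seq 0 N).
Proof.
assert (inj : forall i j, (i < N)%nat -> (j < N)%nat -> cell_of N i = cell_of N j -> i = j).
{ intros i j Hi Hj; unfold cell_of.
  destruct (Nat.eqb_spec i 0), (Nat.eqb_spec j 0); try destruct (Nat.leb_spec (2 * i) N);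
    try destruct (Nat.leb_spec (2 * j) N); lia. }
apply NoDup_Permutation_bis.
- apply NoDup_map_NoDup_ForallPairs; [|apply seq_NoDup].
  intros i j Hi Hj; apply in_seq in Hi; apply in_seq in Hj; apply inj; lia.
- rewrite length_map; lia.
- intros x Hx; apply in_map_iff in Hx; destruct Hx as [i [<- Hi]]; apply in_seq in Hi.
  apply in_seq; unfold cell_of.
  destruct (Nat.eqb_spec i 0); try destruct (Nat.leb_spec (2 * i) N); lia.
Qed.

(** Lifts a one-dimensional reindexing to tuples: [c = 1] serves the permutation of the cells,
    [c = q] the refinement of each cell into [q] pieces. *)
Lemma rsum_tuples_transport N M (A : Type) (u : nat -> A) (v : nat -> A) (c : R) s (f : list A -> R) :
  (forall h : A -> R, rsum (fun i => h (u i)) (seq 0 M) = c * rsum (fun i => h (v i)) (seq 0 N)) ->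
  rsum (fun i => f (map u i)) (tuples s M) = c ^ s * rsum (fun i => f (map v i)) (tuples s N).
Proof.
intros H; revert f; induction s as [|s IH]; intros f; [unfold rsum; simpl; ring|].
rewrite !rsum_tuples_S.
rewrite (rsum_ext _ (fun i => c ^ s * rsum (fun t => f (u i :: map v t)) (tuples s N))).
- rewrite rsum_scal, (H (fun a => rsum (fun t => f (a :: map v t)) (tuples s N))); simpl; ring.
- intros i _; apply (IH (fun t => f (u i :: t))).
Qed.

Lemma grid_avg_cells N s g :
  grid_avg N s g = / (INR N ^ s) * rsum (fun e => g (map (cell_tag N) e)) (tuples s N).
Proof.
unfold grid_avg; f_equal.
rewrite (rsum_tuples_transport N N R (node N) (cell_tag N) 1), pow1; [ring|].
intros h; rewrite Rmult_1_l, <- (rsum_perm (fun e => h (cell_tag N e)) _ _ (cell_of_perm N)), rsum_map.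
apply rsum_ext; intros i Hi; apply in_seq in Hi; now rewrite node_cell_tag by lia.
Qed.

Lemma rsum_seq_div (h : nat -> R) N q : (1 <= q)%nat ->
  rsum (fun i => h (i / q)%nat) (seq 0 (N * q)) = INR q * rsum h (seq 0 N).
Proof.
intros Hq; induction N as [|N IH]; [unfold rsum; simpl; ring|].
rewrite rsum_seq_S, Rmult_plus_distr_l, <- IH.
replace (S N * q)%nat with (N * q + q)%nat by lia.
rewrite seq_app, rsum_app; f_equal.
rewrite (rsum_ext _ (fun _ => h N)), rsum_const, length_seq; [reflexivity|].
intros i Hi; apply in_seq in Hi; f_equal; symmetry; apply (Nat.div_unique _ q _ (i - N * q)); lia.
Qed.

Lemma close_map {A} d (u v : A -> R) l : Forall (fun i => Rabs (u i - v i) <= d) l ->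
  close d (map u l) (map v l).
Proof. induction 1; constructor; assumption. Qed.

Lemma unit_cell M i t : (i < M)%nat -> INR i / INR M <= t <= INR (S i) / INR M -> 0 <= t <= 1.
Proof.
intros Hi Ht; assert (HM : 0 < INR M) by (apply lt_0_INR; lia).
assert (0 < / INR M) by now apply Rinv_0_lt_compat.
assert (INR (S i) / INR M <= 1).
{ apply Rmult_le_reg_r with (INR M); [assumption|].
  unfold Rdiv; rewrite Rmult_assoc, Rinv_l by lra; rewrite Rmult_1_l, Rmult_1_r; apply le_INR; lia. }
assert (0 <= INR i / INR M) by (apply Rmult_le_pos; [apply pos_INR|lra]); lra.
Qed.

(** [is_integral] speaks only of fine meshes, so the fixed grid is viewed on a mesh of [N * q] cells
    per axis, where every fine cell carries the tag of its coarse cell. Tag and fine midpoint then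
    lie in one coarse cell and differ by at most [1 / N] in each coordinate. *)
Lemma grid_avg_integral N s alpha p g L I : (1 <= N)%nat -> 0 < alpha -> valid_p p -> 0 <= L ->
  holder_bound s alpha p g L -> is_integral s g I ->
  Rabs (grid_avg N s g - I) <= L * (s_pow s alpha p / Rpower (INR N) alpha).
Proof.
intros HN Ha Hp HL Hh HI.
assert (HN0 : 0 < INR N) by (apply lt_0_INR; lia).
assert (HNi : 0 < / INR N) by now apply Rinv_0_lt_compat.
apply le_epsilon; intros eps He.
destruct (midpt_riemann s g I eps HI He) as [m0 Hm0].
set (q := S m0); set (m := (N * q)%nat).
assert (Hm1 : (m0 <= m)%nat) by (unfold m, q; nia).
assert (Hm : (1 <= m)%nat) by (unfold m, q; nia).
assert (mp : 0 < INR m ^ s) by now apply pow_INR_pos.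
specialize (Hm0 m Hm1 Hm).
assert (G : grid_avg N s g = / (INR m ^ s) * rsum (fun i => g (map (fun i => cell_tag N (i / q)) i)) (tuples s m)).
{ rewrite grid_avg_cells.
  rewrite (rsum_tuples_transport N m R (fun i => cell_tag N (i / q)) (cell_tag N) (INR q)).
  - unfold m; rewrite mult_INR, Rpow_mult_distr.
    assert (INR q <> 0) by (apply not_0_INR; discriminate).
    field; split; apply pow_nonzero; lra.
  - intros h; apply (rsum_seq_div (fun e => h (cell_tag N e))); unfold q; lia. }
assert (D : Rabs (grid_avg N s g - / (INR m ^ s) * rsum (fun i => g (map (midpt m) i)) (tuples s m))
   <= L * (s_pow s alpha p / Rpower (INR N) alpha)).
{ rewrite G, <- Rmult_minus_distr_l, <- rsum_minus, Rabs_mult, Rabs_right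
    by (left; now apply Rinv_0_lt_compat).
  apply Rmult_le_reg_l with (INR m ^ s); [assumption|].
  rewrite <- Rmult_assoc, Rinv_r, Rmult_1_l by lra.
  eapply Rle_trans; [apply rsum_abs|]; rewrite <- rsum_tuples_const.
  apply rsum_le; intros i Hi.
  assert (Hc1 := mids_cube s m i Hi).
  apply tuples_In in Hi; destruct Hi as [Hl Hf]; rewrite Forall_forall in Hf.
  assert (Hdiv : forall j, In j i -> (j / q < N)%nat).
  { intros j Hj; apply Nat.Div0.div_lt_upper_bound; specialize (Hf j Hj); unfold m in Hf; lia. }
  assert (Hc2 : in_cube s (map (fun i => cell_tag N (i / q)) i)).
  { split; [now rewrite length_map|]; rewrite Forall_map; apply Forall_forall; intros j Hj.
    apply (unit_cell N (j / q)); [now apply Hdiv|now apply cell_tag_cell]. }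
  eapply Rle_trans; [apply (holder_close s alpha p g L (/ INR N)); try eassumption|].
  - apply close_map, Forall_forall; intros j Hj.
    assert (C1 := cell_tag_cell N (j / q) HN).
    assert (C2 := midpt_cell m j Hm).
    assert (E := Nat.div_mod_eq j q); assert (Hmod := Nat.mod_upper_bound j q ltac:(unfold q; lia)).
    assert (Hq : 0 < INR q) by (apply lt_0_INR; unfold q; lia).
    (* [F1] and [F2] place the fine cell [j] inside the coarse cell [j / q]. *)
    assert (F1 : INR (j / q) / INR N <= INR j / INR m).
    { replace (INR (j / q) / INR N) with (INR (q * (j / q)) / INR m).
      - apply Rmult_le_compat_r; [left; apply Rinv_0_lt_compat, lt_0_INR; lia|apply le_INR; lia].
      - unfold m; rewrite !mult_INR; field; lra. }
    assert (F2 : INR (S j) / INR m <= INR (S (j / q)) / INR N).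
    { replace (INR (S (j / q)) / INR N) with (INR (q * S (j / q)) / INR m).
      - apply Rmult_le_compat_r; [left; apply Rinv_0_lt_compat, lt_0_INR; lia|apply le_INR; lia].
      - unfold m; rewrite !mult_INR; field; lra. }
    rewrite (S_INR (j / q)) in *; unfold Rdiv in *; rewrite Rmult_plus_distr_r in *.
    apply Rabs_le; lra.
  - right; unfold Rdiv; rewrite Rmult_assoc; do 2 f_equal.
    rewrite <- Rpower_Ropp; unfold Rpower; rewrite ln_Rinv by assumption; f_equal; ring. }
replace (grid_avg N s g - I) with
  ((grid_avg N s g - / (INR m ^ s) * rsum (fun i => g (map (midpt m) i)) (tuples s m)) +
   (/ (INR m ^ s) * rsum (fun i => g (map (midpt m) i)) (tuples s m) - I)) by ring.
eapply Rle_trans; [apply Rabs_triang|]; lra.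
Qed.

(** * Integration error *)

(** A multi-index is its support together with positive entries there; whether the first entry is
    positive or zero matches the first bit of the mask. The entry zero accounts for [S M]. *)
Lemma coefsum_tuples s c M :
  rsum (fun k => amps k * Rabs (c k)) (tuples s (S M)) = coefsum s c M.
Proof.
unfold coefsum; revert c; induction s as [|s IH]; intros c; [unfold rsum, amps; simpl; ring|].
rewrite rsum_tuples_S; change (seq 0 (S M)) with (0%nat :: seq 1 M); rewrite rsum_cons.
assert (E : forall i, rsum (fun t => amps (i :: t) * Rabs (c (i :: t))) (tuples s (S M)) =
  amp i * rsum (fun b => sqrt 2 ^ count_occ Bool.bool_dec b true *
    rsum (fun k => Rabs (c (i :: k))) (ktuples b M)) (blists s)).
{ intros i; rewrite <- (IH (fun t => c (i :: t))), <- rsum_scal.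
  apply rsum_ext; intros t _; unfold amps; simpl; ring. }
rewrite E; simpl (amp 0); rewrite Rmult_1_l.
rewrite (rsum_ext (fun i => rsum _ _) (fun i => sqrt 2 * rsum (fun b => sqrt 2 ^ count_occ Bool.bool_dec b true *
    rsum (fun k => Rabs (c (i :: k))) (ktuples b M)) (blists s))).
2: { intros [|i] Hi; apply in_seq in Hi; [lia|apply E]. }
rewrite rsum_scal, rsum_swap.
change (blists (S s)) with (map (cons true) (blists s) ++ map (cons false) (blists s) ++ nil).
rewrite app_nil_r, rsum_app, !rsum_map, Rplus_comm; f_equal.
- rewrite <- rsum_scal; apply rsum_ext; intros b _; simpl ktuples; rewrite rsum_flat_map.
  rewrite (rsum_ext (fun i => rsum _ (map (cons i) _)) (fun i => rsum (fun k => Rabs (c (i :: k))) (ktuples b M)))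
    by (intros; now rewrite rsum_map).
  rewrite rsum_scal; simpl; ring.
- apply rsum_ext; intros b _; simpl ktuples; rewrite rsum_map; simpl; ring.
Qed.

Lemma avg_error (l : list (list R)) (f h : list R -> R) eps w : 0 <= w -> w * INR (length l) = 1 ->
  (forall x, In x l -> Rabs (f x - h x) <= eps) -> Rabs (w * rsum f l - w * rsum h l) <= eps.
Proof.
intros Hw Hl H; rewrite <- Rmult_minus_distr_l, <- rsum_minus, Rabs_mult, Rabs_right by lra.
apply Rle_trans with (w * (INR (length l) * eps)); [|right; rewrite <- Rmult_assoc, Hl; ring].
apply Rmult_le_compat_l; [assumption|].
eapply Rle_trans; [apply rsum_abs|]; rewrite <- rsum_const; now apply rsum_le.
Qed.

Theorem mainTheorem5 (alpha : R) (p : pexp) (N s : nat)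
  (Halpha : 0 < alpha <= 1) (Hp : valid_p p) (HN : prime (Z.of_nat N))
  (Hs1 : (1 <= s)%nat) (HsN : (s < N)%nat) :
  forall (g : list R -> R) (I : R),
    in_unit_ball s alpha p g -> is_integral s g I ->
    Rabs (I - qmc_avg N s g) <=
      Rmax ((INR s - 1) / sqrt (INR N)) (s_pow s alpha p / Rpower (INR N) alpha).
Proof.
intros g I [c [S0 [L [Hc [HS [HL [Hh Hball]]]]]]] HI.
assert (N2 : (2 <= N)%nat) by (apply prime_ge_2 in HN; lia).
assert (HN0 : 0 < INR N) by (apply lt_0_INR; lia).
set (A := (INR s - 1) / sqrt (INR N)); set (B := s_pow s alpha p / Rpower (INR N) alpha).
assert (HA : 0 <= A).
{ apply Rmult_le_pos; [|left; apply Rinv_0_lt_compat; now apply sqrt_lt_R0].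
  assert (1 <= INR s) by (apply (le_INR 1); assumption); lra. }
assert (HG := grid_avg_integral N s alpha p g L I ltac:(lia) ltac:(lra) Hp HL Hh HI).
fold B in HG.
(* Replacing [g] by its Fejer mean [P] changes both averages by at most [eps / 2], and for [P] the
   difference is estimated frequency by frequency. *)
assert (key : Rabs (qmc_avg N s g - grid_avg N s g) <= A * S0).
{ apply le_epsilon; intros eps He.
  destruct (fejer_means_converge s alpha p g c L (eps / 2) ltac:(lra) Hp HL Hh Hc ltac:(lra)) as [M [HM1 HM]].
  destruct M as [|M]; [lia|].
  set (P := fun x => rsum (fun k => fws (S M) k * c k * sigma k x) (tuples s (S M))) in *.
  assert (E1 : Rabs (qmc_avg N s g - qmc_avg N s P) <= eps / 2).
  { unfold qmc_avg; rewrite <- !(rsum_map _ (ypt N s)); apply avg_error.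
    - left; now apply Rinv_0_lt_compat.
    - rewrite length_map, length_seq; apply Rinv_l; lra.
    - intros x Hx; apply in_map_iff in Hx; destruct Hx as [n [<- _]]; apply HM.
      rewrite ypt_node by lia; split; [now rewrite length_map, length_seq|].
      rewrite Forall_map; apply Forall_forall; intros j _; apply node_unit, Nat.mod_upper_bound; lia. }
  assert (E2 : Rabs (grid_avg N s g - grid_avg N s P) <= eps / 2).
  { unfold grid_avg; rewrite <- !(rsum_map _ (map (node N))); apply avg_error.
    - left; apply Rinv_0_lt_compat, pow_lt; assumption.
    - rewrite length_map, <- (Rmult_1_r (INR (length _))), <- rsum_const, rsum_tuples_const.
      field; apply pow_nonzero; lra.
    - intros x Hx; apply in_map_iff in Hx; destruct Hx as [t [<- Ht]]; apply HM.
      apply tuples_In in Ht; destruct Ht as [Hl Hf]; split; [now rewrite length_map|].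
      rewrite Forall_map; eapply Forall_impl; [|exact Hf]; intros j Hj; now apply node_unit. }
  assert (E3 : Rabs (qmc_avg N s P - grid_avg N s P) <= A * S0).
  { assert (Q1 : qmc_avg N s P = rsum (fun k => fws (S M) k * c k * qmc_avg N s (sigma k)) (tuples s (S M))).
    { unfold qmc_avg, P; rewrite rsum_swap, <- rsum_scal; apply rsum_ext; intros k _.
      rewrite rsum_scal; ring. }
    assert (Q2 : grid_avg N s P = rsum (fun k => fws (S M) k * c k * grid_avg N s (sigma k)) (tuples s (S M))).
    { unfold grid_avg, P; rewrite rsum_swap, <- rsum_scal; apply rsum_ext; intros k _.
      rewrite rsum_scal; ring. }
    rewrite Q1, Q2, <- rsum_minus.
    eapply Rle_trans; [apply rsum_abs|].
    apply Rle_trans with (rsum (fun k => A * (amps k * Rabs (c k))) (tuples s (S M))).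
    - apply rsum_le; intros k Hk; apply tuples_In in Hk; destruct Hk as [Hl Hf].
      assert (W := fws_bounds (S M) k Hf).
      assert (QG := qmc_grid_sigma N s k HN Hs1 HsN Hl); fold A in QG.
      rewrite <- Rmult_minus_distr_l, !Rabs_mult, (Rabs_right (fws _ _)) by lra.
      assert (0 <= Rabs (c k)) by apply Rabs_pos.
      set (X := Rabs (qmc_avg N s (sigma k) - grid_avg N s (sigma k))) in *.
      assert (0 <= X) by apply Rabs_pos.
      assert (0 <= Rabs (c k) * X) by now apply Rmult_le_pos.
      (* The Fejer weight is at most [1], so the estimate is uniform in [M]. *)
      apply Rle_trans with (Rabs (c k) * X); [rewrite Rmult_assoc; nra|].
      replace (A * (amps k * Rabs (c k))) with (Rabs (c k) * (amps k * A)) by ring.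
      now apply Rmult_le_compat_l.
    - rewrite rsum_scal, coefsum_tuples; apply Rmult_le_compat_l; [assumption|apply HS]. }
  replace (qmc_avg N s g - grid_avg N s g) with
    ((qmc_avg N s g - qmc_avg N s P) + (qmc_avg N s P - grid_avg N s P)
      - (grid_avg N s g - grid_avg N s P)) by ring.
  unfold Rminus at 1; eapply Rle_trans; [apply Rabs_triang|]; rewrite Rabs_Ropp.
  eapply Rle_trans; [apply Rplus_le_compat_r, Rabs_triang|]; lra. }
assert (S0pos : 0 <= S0).
{ eapply Rle_trans; [|apply (HS 0%nat)]; rewrite <- coefsum_tuples; apply rsum_nonneg; intros k _.
  apply Rmult_le_pos; [apply amps_nonneg|apply Rabs_pos]. }
(* As [2^alpha >= 1], the ball condition gives [S0 + L <= 1], so [A * S0 + B * L] is at most the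
   maximum of [A] and [B]. *)
assert (two : 1 <= Rpower 2 alpha).
{ rewrite <- (Rpower_O 2) by lra; apply Rle_Rpower; lra. }
assert (HL2 : S0 + L <= 1) by nra.
replace (I - qmc_avg N s g) with (- ((qmc_avg N s g - grid_avg N s g) + (grid_avg N s g - I))) by ring.
rewrite Rabs_Ropp; eapply Rle_trans; [apply Rabs_triang|].
assert (MA := Rmax_l A B); assert (MB := Rmax_r A B); set (X := Rmax A B) in *.
assert (0 <= X) by lra; nra.
Qed.
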